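(* Let $k\ge0$ be an integer, and let $V\in B^k$ satisfy $(2\pi)^{-n}\|V\|_{B^0}<1$. There exists a constant $\mathbf c=\mathbf c(n,k,V)>0$ such that for all $f\in B^k$, the (unique) solution $\mathbf u\in B^2$ of $$(1-\Delta+V)u=f\quad\text{in }\mathbb R^n$$ satisfies $\mathbf u\in B^{k+2}$, and $$\|\mathbf u\|_{B^{k+2}}\le\mathbf c\,\|f\|_{B^k}.$$
   Context: Functions are complex valued on $\mathbb R^n$; $\hat f(\xi)=\int_{\mathbb R^n}e^{-ix\cdot\xi}f(x)\,dx$ is the Fourier transform (extended to tempered distributions); $\langle\xi\rangle=\sqrt{1+|\xi|^2}$; $C_b^0$ is the space of bounded continuous functions on $\mathbb R^n$. For $s\ge0$, $B^s=\{f\in C_b^0:\ \langle\xi\rangle^s\hat f\in L^1(\mathbb R^n)\}$ with norm $\|f\|_{B^s}=\|\langle\xi\rangle^s\hat f\|_{L^1}$ (a Banach space). Under the condition $(2\pi)^{-n}\|V\|_{B^0}<1$, the equation $(1-\Delta+V)u=f$ has a unique solution in $B^2$ for every $f\in B^0$. *)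

(* Defs.v *)
From HB Require Import structures.
From mathcomp Require Import all_boot all_order all_algebra.
From mathcomp Require Import all_classical all_reals all_analysis.
From mathcomp Require Import complex.

Set Implicit Arguments.
Unset Strict Implicit.
Unset Printing Implicit Defensive.
Import Order.TTheory GRing.Theory Num.Theory.
Import numFieldNormedType.Exports.
Local Open Scope classical_set_scope.
Local Open Scope ring_scope.
Local Open Scope complex_scope.

(* The library puts a topology and derivatives on ['rV[R]_n], and a
   sigma-algebra on tuples; points of R^n are row vectors, and integration over
   R^n takes place on tuples through [rowv]. *)
Section lebesgue_measure_Rn.
Context (R : realType).

Local Notation tupleR n := (n.-tuple (measurableTypeR R)).

Local Notation lambda :=
  (lebesgue_measure : {sigma_finite_measure set (measurableTypeR R) -> \bar R}).

Definition rowv n (t : tupleR n) : 'rV[R]_n := \row_i tnth t i.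

Definition consR n (p : measurableTypeR R * tupleR n) : tupleR n.+1 :=
  [tuple of p.1 :: p.2].

Lemma measurable_consR n : measurable_fun setT (@consR n).
Proof. exact: measurable_cons measurable_fst measurable_snd. Qed.

Section step.
Context (n : nat) (m : {sigma_finite_measure set (tupleR n) -> \bar R}).

Definition lebesgue_step : set (tupleR n.+1) -> \bar R :=
  pushforward (lambda \x m)%E (@consR n).

Let step0 : lebesgue_step set0 = 0%E.
Proof. by rewrite /lebesgue_step /pushforward preimage_set0 measure0. Qed.

Let step_ge0 A : (0 <= lebesgue_step A)%E.
Proof. by rewrite /lebesgue_step /pushforward measure_ge0. Qed.

Let step_sigma_additive : semi_sigma_additive lebesgue_step.
Proof.
move=> F mF tF mUF; rewrite /lebesgue_step /pushforward preimage_bigcup.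
apply: measure_semi_sigma_additive.
- by move=> k; rewrite -[X in measurable X]setTI; exact: measurable_consR.
- apply/trivIsetP => /= i j _ _ ij; rewrite -preimage_setI.
  by move/trivIsetP : tF => /(_ _ _ _ _ ij) ->//; rewrite preimage_set0.
- rewrite -preimage_bigcup -[X in measurable X]setTI.
  exact: measurable_consR.
Qed.

HB.instance Definition _ := isMeasure.Build _ _ _
  lebesgue_step step0 step_ge0 step_sigma_additive.

Let step_sigma_finite : sigma_finite setT lebesgue_step.
Proof.
have /sigma_finiteP[F [TF ndF Foo]] := sigma_finiteT lambda.
have /sigma_finiteP[G [TG ndG Goo]] := sigma_finiteT m.
pose u (t : tupleR n.+1) : (measurableTypeR R * tupleR n)%type :=
  (thead t, [tuple of behead t]).
have mu_ : measurable_fun setT u.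
  apply/measurable_fun_pairP; split; first exact: measurable_tnth.
  exact: measurable_behead.
exists (fun k => u @^-1` (F k `*` G k)).
  rewrite -preimage_bigcup (_ : \bigcup_k _ = setT) ?preimage_setT//.
  rewrite -setXTT TF TG predeqE => -[x y]; split; last first.
    move=> [/= [k _ Fkx] [l _ Gly]]; exists (maxn k l) => //; split.
    - by move: x Fkx; exact/subsetPset/ndF/leq_maxl.
    - by move: y Gly; exact/subsetPset/ndG/leq_maxr.
  by move=> [k _ []/= ? ?]; split; exists k.
move=> k; have [mF Fk] := Foo k; have [mG Gk] := Goo k; split.
  by rewrite -[X in measurable X]setTI; apply: mu_ => //; exact: measurableX.
rewrite /lebesgue_step /pushforward -comp_preimage.
rewrite (_ : u \o _ = id); last first.
  rewrite funeqE => -[x t] /=.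
  by rewrite /u /consR /= theadE; congr pair; apply: val_inj.
rewrite preimage_id product_measure1E// lte_mul_pinfty//.
by rewrite ge0_fin_numE.
Qed.

HB.instance Definition _ := Measure_isSigmaFinite.Build _ _ _
  lebesgue_step step_sigma_finite.

End step.

Definition lebesgue_step0 : set (tupleR 0) -> \bar R := \d_ [tuple].
HB.instance Definition _ := FiniteMeasure.on lebesgue_step0.

Fixpoint lebesgueRn n : {sigma_finite_measure set (tupleR n) -> \bar R} :=
  match n with
  | 0 => lebesgue_step0
  | m.+1 => lebesgue_step (lebesgueRn m)
  end.

End lebesgue_measure_Rn.

Section fourier_spaces.
Context (R : realType) (n : nat).
Local Notation Rn := 'rV[R]_n.
Local Notation C := R[i].

Definition dot (x y : Rn) : R := \sum_(i < n) x ord0 i * y ord0 i.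

(* [`|x|] on ['rV[R]_n] is the sup norm, hence the explicit Euclidean norm. *)
Definition jbracket (x : Rn) : R := Num.sqrt (1 + dot x x).

Definition expi (t : R) : C := cos t +i* sin t.

Definition cintegrable (f : Rn -> C) : Prop :=
  (lebesgueRn R n).-integrable setT (fun t => (complex.Re (f (rowv t)))%:E) /\
  (lebesgueRn R n).-integrable setT (fun t => (complex.Im (f (rowv t)))%:E).

Definition cintegral (f : Rn -> C) : C :=
  (\int[lebesgueRn R n]_t complex.Re (f (rowv t))) +i*
  (\int[lebesgueRn R n]_t complex.Im (f (rowv t))).

Definition Cb (f : Rn -> C) : Prop :=
  [/\ continuous (fun x => complex.Re (f x)),
      continuous (fun x => complex.Im (f x)) &
      exists M : R, forall x, Normc.normc (f x) <= M].

Definition pderiv (i : 'I_n) (f : Rn -> R) : Rn -> R := 'D_(delta_mx ord0 i) f.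

Definition pderivs (s : seq 'I_n) (f : Rn -> R) : Rn -> R := foldr pderiv f s.

Definition rschwartz (f : Rn -> R) : Prop :=
  forall s : seq 'I_n,
    (forall x, differentiable (pderivs s f) x) /\
    forall N : nat, exists M : R,
      forall x, jbracket x ^+ N * `|pderivs s f x| <= M.

Definition schwartz (phi : Rn -> C) : Prop :=
  rschwartz (fun x => complex.Re (phi x)) /\
  rschwartz (fun x => complex.Im (phi x)).

Definition laplacian (phi : Rn -> C) (x : Rn) : C :=
  (\sum_(i < n) pderivs [:: i; i] (fun y => complex.Re (phi y)) x) +i*
  (\sum_(i < n) pderivs [:: i; i] (fun y => complex.Im (phi y)) x).

Definition fourier (phi : Rn -> C) (xi : Rn) : C :=
  cintegral (fun x => expi (- dot x xi) * phi x).

(* Tempered distributions are represented by their action on test functions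
   and compared on Schwartz functions only. *)
Definition distribution := (Rn -> C) -> C.

Definition eq_distribution (S T : distribution) : Prop :=
  forall phi, schwartz phi -> S phi = T phi.

Definition distribution_of (f : Rn -> C) : distribution :=
  fun phi => cintegral (fun x => f x * phi x).

Definition fourier_distribution (T : distribution) : distribution :=
  fun phi => T (fourier phi).

Definition laplacian_distribution (T : distribution) : distribution :=
  fun phi => T (laplacian phi).

(* The distribution \hat f is the integrable function [g]. *)
Definition is_fourier (f g : Rn -> C) : Prop :=
  cintegrable g /\
  eq_distribution (fourier_distribution (distribution_of f)) (distribution_of g).

(* A representative of \hat f; it is only determined almost everywhere. *)
Definition hat (f : Rn -> C) : Rn -> C := xget (fun=> 0) [set g | is_fourier f g].

(* Since s >= 0, asking for \hat f to be a function in L^1 is no restriction: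
   |\hat f| <= <xi>^s |\hat f|. *)
Definition B (s : R) (f : Rn -> C) : Prop :=
  Cb f /\
  exists2 g, is_fourier f g &
    cintegrable (fun xi => (jbracket xi `^ s)%:C * g xi).

Definition normB (s : R) (f : Rn -> C) : \bar R :=
  (\int[lebesgueRn R n]_t
    (jbracket (rowv t) `^ s * Normc.normc (hat f (rowv t)))%:E)%E.

(* (1 - Delta + V) u = f in the sense of tempered distributions *)
Definition solves (V f u : Rn -> C) : Prop :=
  eq_distribution
    (fun phi => distribution_of u phi
                - laplacian_distribution (distribution_of u) phi
                + distribution_of (fun x => V x * u x) phi)
    (distribution_of f).

End fourier_spaces.

(* Main.v *)
(* Test functions: only the modulated Gaussians
   [x |-> e^{-i x.c} e^{- r^2 |x|^2 / 2}] are needed.  Their Fourier integrals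
   are again Gaussians, centred at [c], which form an approximate identity.
   Testing the distributional definition of [hat f] against them gives the
   inversion formula for bounded continuous [f], hence the uniqueness of [hat f];
   testing the equation gives, almost everywhere,
     [<xi>^2 hat u = hat f - (2 pi)^-n (hat V * hat u)].
   Put [N_j g := \int <xi>^j |g|].  Since [<x + y> <= 2 <x> <y>],
     [N_{j+2} (hat u) <= N_j (hat f) + (2 pi)^-n 2^j N_j (hat V) N_j (hat u)],
   where the factor [2^j] is [1] for [j = 0].  As [N_0 (hat u) <= N_2 (hat u)] is
   finite, smallness of [V] bounds it by a multiple of [N_0 (hat f)], and the
   inequality climbs from [N_j] to [N_{j+1} <= N_{j+2}] as long as [j <= k]. *)

Require Import Defs.
From mathcomp Require Import all_boot all_order all_algebra.
From mathcomp Require Import all_classical all_reals all_analysis.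
From mathcomp Require Import measurable_realfun complex.
From mathcomp Require Import ring lra.

Set Implicit Arguments.
Unset Strict Implicit.
Unset Printing Implicit Defensive.
Import Order.TTheory GRing.Theory Num.Theory.
Import numFieldNormedType.Exports.
Local Open Scope classical_set_scope.
Local Open Scope ring_scope.
Local Open Scope complex_scope.

(** The hypotheses give access to [hat f] only through Schwartz test functions, and for a test
    function [phi] neither [u phi] nor [V u phi] need be Schwartz. Pointwise inversion removes this
    obstacle: once a bounded continuous function is an absolutely convergent Fourier integral,
    Fubini pairs it with any integrable function, and two such pairings turn the product [V u] into
    a convolution. Gaussians are convenient test functions because they are tensor products: their
    Fourier integrals, and those of their Laplacians, reduce to moments of order at most 2 on the
    line. The climb has its form because smallness concerns the [B^0] norm alone. At order [j > 0]
    the constant [2^j N_j (hat V)] may be large, so absorbing the term in [u] is possible at order 0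
    only, and each higher order must be bounded by a lower one. The room for this is the gain of two
    orders from dividing by [<xi>^2], while multiplication by [V] costs nothing up to order [k]. *)

Local Notation Re := complex.Re.
Local Notation Im := complex.Im.
Local Notation normc := Normc.normc.

(** * Complex-valued integrals *)

Section complex_modulus.
Context {R : realType}.
Implicit Types z w : R[i].

Lemma RecD z w : Re (z + w) = Re z + Re w. Proof. by case: z w => [? ?] []. Qed.
Lemma ImcD z w : Im (z + w) = Im z + Im w. Proof. by case: z w => [? ?] []. Qed.
Lemma RecN z : Re (- z) = - Re z. Proof. by case: z. Qed.
Lemma ImcN z : Im (- z) = - Im z. Proof. by case: z. Qed.
Lemma RecM z w : Re (z * w) = Re z * Re w - Im z * Im w.
Proof. by case: z w => [? ?] []. Qed.
Lemma ImcM z w : Im (z * w) = Re z * Im w + Im z * Re w.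
Proof. by case: z w => [? ?] []. Qed.

Lemma eq_complexP z w : Re z = Re w -> Im z = Im w -> z = w.
Proof. by case: z w => [a b] [c d] /= -> ->. Qed.

Lemma normc_ge0 z : 0 <= normc z.
Proof. by case: z => a b; exact: sqrtr_ge0. Qed.

Lemma normcEsqr z : normc z ^+ 2 = Re z ^+ 2 + Im z ^+ 2.
Proof. by case: z => a b /=; rewrite sqr_sqrtr// addr_ge0// sqr_ge0. Qed.

Lemma Re_le_normc z : `|Re z| <= normc z.
Proof.
case: z => a b /=; rewrite -sqrtr_sqr; apply: ler_wsqrtr.
by rewrite lerDl sqr_ge0.
Qed.

Lemma Im_le_normc z : `|Im z| <= normc z.
Proof.
case: z => a b /=; rewrite -sqrtr_sqr; apply: ler_wsqrtr.
by rewrite lerDr sqr_ge0.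
Qed.

Lemma normc_le_ReIm z : normc z <= `|Re z| + `|Im z|.
Proof.
rewrite -(@ler_pXn2r _ 2)// ?nnegrE ?normc_ge0 ?addr_ge0//.
rewrite normcEsqr -(real_normK (num_real (Re z))) -(real_normK (num_real (Im z))).
by rewrite sqrrD -addrA lerD2l lerDr mulrn_wge0// mulr_ge0.
Qed.

Lemma normc_real (r : R) : normc r%:C = `|r|.
Proof. by rewrite /= expr0n addr0 sqrtr_sqr. Qed.

Lemma real_complexM (x y : R) : (x * y)%:C = x%:C * y%:C :> R[i].
Proof. by apply: eq_complexP; rewrite /= ?mul0r ?mulr0 ?subr0 ?addr0. Qed.

Lemma real_complexX (x : R) k : (x ^+ k)%:C = x%:C ^+ k :> R[i].
Proof. by elim: k => [//|k ih]; rewrite !exprS real_complexM ih. Qed.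

Lemma real_complex_prod (I : Type) (s : seq I) (F : I -> R) :
  (\prod_(i <- s) F i)%:C = \prod_(i <- s) (F i)%:C :> R[i].
Proof. by rewrite (big_morph (real_complex R) real_complexM erefl). Qed.

Lemma real_complex_sum (I : Type) (s : seq I) (F : I -> R) :
  (\sum_(i <- s) F i)%:C = \sum_(i <- s) (F i)%:C :> R[i].
Proof.
rewrite (big_morph (real_complex R) (id1 := 0) (op1 := +%R))//.
by move=> x y; apply: eq_complexP; rewrite /= ?addr0.
Qed.

Lemma expiD (s t : R) : expi (s + t) = expi s * expi t.
Proof.
by apply: eq_complexP; rewrite ?RecM ?ImcM/= ?cosD ?sinD//; ring.
Qed.

Lemma expi0 : expi (0 : R) = 1.
Proof. by rewrite /expi cos0 sin0. Qed.

Lemma normc_expi (t : R) : normc (expi t) = 1.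
Proof. by rewrite /= cos2Dsin2 sqrtr1. Qed.

End complex_modulus.

Section complex_integral.
Context d (T : measurableType d) (R : realType).
Implicit Types (f g : T -> R[i]).

Definition cmeasurable f :=
  measurable_fun setT (fun x => Re (f x)) /\
  measurable_fun setT (fun x => Im (f x)).

Lemma cmeasurableM f g :
  cmeasurable f -> cmeasurable g -> cmeasurable (fun x => f x * g x).
Proof.
move=> [rf jf] [rg jg]; split.
- under eq_fun do rewrite RecM.
  by apply: measurable_funB; exact: measurable_funM.
- under eq_fun do rewrite ImcM.
  by apply: measurable_funD; exact: measurable_funM.
Qed.

Lemma cmeasurable_cst (c : R[i]) : cmeasurable (fun=> c).
Proof. by split; exact: measurable_cst. Qed.

Lemma cmeasurable_real (f : T -> R) :
  measurable_fun setT f -> cmeasurable (fun x => (f x)%:C).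
Proof. by move=> mf; split => //; exact: measurable_cst. Qed.

Lemma cmeasurable_expi (f : T -> R) :
  measurable_fun setT f -> cmeasurable (fun x => expi (f x)).
Proof.
move=> mf; split => /=; (apply: measurableT_comp => //;
  apply: continuous_measurable_fun);
  [exact: continuous_cos|exact: continuous_sin].
Qed.

Lemma measurable_normc f :
  cmeasurable f -> measurable_fun setT (fun x => normc (f x)).
Proof.
move=> [rf jf]; rewrite (_ : (fun _ => _) =
  Num.sqrt \o (fun x => Re (f x) ^+ 2 + Im (f x) ^+ 2)); last first.
  by apply/funext => x /=; rewrite -normcEsqr sqrtr_sqr ger0_norm// normc_ge0.
apply: measurableT_comp.
  by apply: continuous_measurable_fun; exact: sqrt_continuous.
by apply: measurable_funD; apply: measurable_funX.
Qed.

Section with_measure.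
Variable mu : {measure set T -> \bar R}.

(** Composed with [rowv], these are [cintegrable] and [cintegral] up to conversion. An arbitrary
    measure space is allowed because the line and product spaces occur as well. *)
Definition cintble f :=
  mu.-integrable setT (fun x => (Re (f x))%:E) /\
  mu.-integrable setT (fun x => (Im (f x))%:E).

Definition cint f : R[i] :=
  (\int[mu]_x Re (f x)) +i* (\int[mu]_x Im (f x)).

Lemma Re_cint f : Re (cint f) = \int[mu]_x Re (f x). Proof. by []. Qed.
Lemma Im_cint f : Im (cint f) = \int[mu]_x Im (f x). Proof. by []. Qed.

Lemma cintble_measurable f : cintble f -> cmeasurable f.
Proof.
by move=> [/integrableP[/measurable_EFinP ? _] /integrableP[/measurable_EFinP]].
Qed.

Lemma cintble_le f (g : T -> R) : cmeasurable f ->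
  mu.-integrable setT (fun x => (g x)%:E) ->
  (forall x, normc (f x) <= g x) -> cintble f.
Proof.
move=> [rf jf] ig fg; split; apply: (le_integrable _ _ _ ig) => //=.
- exact/measurable_EFinP.
- move=> x _; rewrite !lee_fin (ger0_norm (le_trans (normc_ge0 (f x)) (fg x))).
  exact: le_trans (Re_le_normc _) (fg x).
- exact/measurable_EFinP.
- move=> x _; rewrite !lee_fin (ger0_norm (le_trans (normc_ge0 (f x)) (fg x))).
  exact: le_trans (Im_le_normc _) (fg x).
Qed.

Lemma cintble_normc f : cintble f ->
  mu.-integrable setT (fun x => (normc (f x))%:E).
Proof.
move=> fi; have [rf jf] := fi.
apply: (le_integrable measurableT _ _
  (integrableD measurableT (integrable_norm rf) (integrable_norm jf))).
- apply/measurable_EFinP; apply: measurable_normc.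
  exact: cintble_measurable.
- move=> x _; rewrite /comp -EFinD lee_fin (ger0_norm (normc_ge0 _)).
  rewrite [leRHS]ger0_norm ?addr_ge0//; exact: normc_le_ReIm.
Qed.

Lemma cintbleP f : cintble f <->
  cmeasurable f /\ (\int[mu]_x (normc (f x))%:E < +oo)%E.
Proof.
split=> [fi|[mf foo]].
  split; first exact: cintble_measurable.
  have /integrableP[_] := cintble_normc fi; apply: le_lt_trans.
  rewrite le_eqVlt; apply/orP; left; apply/eqP/eq_integral => x _ /=.
  by rewrite ger0_norm// normc_ge0.
apply: (@cintble_le _ (fun x => normc (f x))) => //.
apply/integrableP; split; first exact/measurable_EFinP/measurable_normc.
apply: le_lt_trans foo.
rewrite le_eqVlt; apply/orP; left; apply/eqP/eq_integral => x _ /=.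
by rewrite ger0_norm// normc_ge0.
Qed.

Lemma cintbleD f g : cintble f -> cintble g -> cintble (fun x => f x + g x).
Proof.
move=> [rf jf] [rg jg]; split.
- under eq_fun do rewrite RecD EFinD; exact: integrableD.
- under eq_fun do rewrite ImcD EFinD; exact: integrableD.
Qed.

Lemma cintble_bounded (b : T -> R[i]) f (M : R) : cmeasurable b ->
  (forall x, normc (b x) <= M) -> cintble f -> cintble (fun x => b x * f x).
Proof.
move=> mb bM fi.
apply: (@cintble_le _ (fun x => M * normc (f x))).
- exact: cmeasurableM mb (cintble_measurable fi).
- by under eq_fun do rewrite EFinM; apply: integrableZl => //;
    exact: cintble_normc.
- by move=> x; rewrite Normc.normcM ler_wpM2r ?normc_ge0.
Qed.

Lemma cintbleZ (c : R[i]) f : cintble f -> cintble (fun x => c * f x).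
Proof.
by apply: (@cintble_bounded _ _ (normc c)) => //; exact: cmeasurable_cst.
Qed.

Lemma cintbleB f g : cintble f -> cintble g -> cintble (fun x => f x - g x).
Proof.
move=> fi gi; under eq_fun do rewrite -mulN1r.
by apply: cintbleD => //; exact: cintbleZ.
Qed.

Lemma cintble0 : cintble (fun=> 0).
Proof. by split; exact: integrable0. Qed.

Lemma cintble_sum I (s : seq I) (F : I -> T -> R[i]) :
  (forall i, cintble (F i)) -> cintble (fun x => \sum_(i <- s) F i x).
Proof.
move=> Fi; elim: s => [|i s ih].
  by under eq_fun do rewrite big_nil; exact: cintble0.
by under eq_fun do rewrite big_cons; exact: cintbleD.
Qed.

Lemma cintD f g : cintble f -> cintble g ->
  cint (fun x => f x + g x) = cint f + cint g.
Proof.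
move=> [rf jf] [rg jg]; apply: eq_complexP; rewrite ?RecD ?ImcD /=.
- by under eq_Rintegral do rewrite RecD; rewrite RintegralD.
- by under eq_Rintegral do rewrite ImcD; rewrite RintegralD.
Qed.

Lemma cintZ (c : R[i]) f : cintble f ->
  cint (fun x => c * f x) = c * cint f.
Proof.
move=> [rf jf].
have Zl (r : R) (h : T -> R) : mu.-integrable setT (fun x => (h x)%:E) ->
    mu.-integrable setT (EFin \o (fun x => (r * h x))).
  by move=> ih; rewrite /comp; under eq_fun do rewrite EFinM; exact: integrableZl.
apply: eq_complexP; rewrite ?RecM ?ImcM /=.
- under eq_Rintegral do rewrite RecM.
  by rewrite RintegralB//; [rewrite !RintegralZl|exact: Zl..].
- under eq_Rintegral do rewrite ImcM.
  by rewrite RintegralD//; [rewrite !RintegralZl|exact: Zl..].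
Qed.

Lemma cintB f g : cintble f -> cintble g ->
  cint (fun x => f x - g x) = cint f - cint g.
Proof.
move=> fi gi; rewrite -[in RHS]mulN1r -cintZ// -cintD//; last exact: cintbleZ.
by congr cint; apply/funext => x; rewrite mulN1r.
Qed.

Lemma cint0 : cint (fun=> 0) = 0.
Proof. by apply: eq_complexP => /=; rewrite Rintegral_cst// mul0r. Qed.

Lemma cint_sum I (s : seq I) (F : I -> T -> R[i]) :
  (forall i, cintble (F i)) ->
  cint (fun x => \sum_(i <- s) F i x) = \sum_(i <- s) cint (F i).
Proof.
move=> Fi; elim: s => [|i s ih].
  by rewrite big_nil -[RHS]cint0; congr cint; apply/funext => x; rewrite big_nil.
rewrite big_cons -ih -cintD//; last exact: cintble_sum.
by congr cint; apply/funext => x; rewrite big_cons.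
Qed.

Lemma eq_cint f g : f =1 g -> cint f = cint g.
Proof. by move=> /funext ->. Qed.

Lemma ae_eq_cint f g : cmeasurable f -> cmeasurable g -> ae_eq mu setT f g ->
  cint f = cint g.
Proof.
move=> [rf jf] [rg jg] fg; apply: eq_complexP; congr fine.
- apply: ae_eq_integral => //; [exact/measurable_EFinP..|].
  by move: fg; apply: filterS => x /(_ I) -> _.
- apply: ae_eq_integral => //; [exact/measurable_EFinP..|].
  by move: fg; apply: filterS => x /(_ I) -> _.
Qed.

Lemma cint_real (f : T -> R) : cint (fun x => (f x)%:C) = (\int[mu]_x f x)%:C.
Proof. by apply: eq_complexP => //=; rewrite Rintegral_cst// mul0r. Qed.

Lemma Re_cintM_real f (g : T -> R) :
  Re (cint (fun x => f x * (g x)%:C)) = \int[mu]_x (Re (f x) * g x).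
Proof. by rewrite /cint /=; apply: eq_Rintegral => x _; rewrite RecM /= mulr0 subr0. Qed.

Lemma Im_cintM_real f (g : T -> R) :
  Im (cint (fun x => f x * (g x)%:C)) = \int[mu]_x (Im (f x) * g x).
Proof. by rewrite /cint /=; apply: eq_Rintegral => x _; rewrite ImcM /= mulr0 add0r. Qed.

(* Rotating [cint f] onto the positive half-line makes its modulus the integral
   of a real part. *)
Lemma normc_cint f : cintble f -> normc (cint f) <= \int[mu]_x normc (f x).
Proof.
move=> fi; have [z zE] : exists z, z = cint f by exists (cint f).
rewrite -zE.
have [/eqP z0|z0] := boolP (normc z == 0).
  by rewrite z0 Rintegral_ge0// => x _; exact: normc_ge0.
have zp : 0 < normc z by rewrite lt_neqAle eq_sym z0 normc_ge0.
pose w : R[i] := (normc z)^-1%:C * (Re z -i* Im z).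
have w1 : normc w = 1.
  rewrite Normc.normcM normc_real ger0_norm ?invr_ge0 ?normc_ge0//.
  have -> : normc (Re z -i* Im z) = normc z by case: (z) => a b /=; rewrite sqrrN.
  by rewrite mulVf.
have wz : Re (w * z) = normc z.
  have := normcEsqr z; rewrite !expr2 RecM /w RecM ImcM.
  move: z0; move: (normc z) => r r0 rE.
  rewrite /= !mul0r subr0 addr0 mulrN mulNr opprK -!mulrA -mulrDr -rE.
  by rewrite mulrA mulVf ?mul1r.
have wfi : cintble (fun x => w * f x) by exact: cintbleZ.
rewrite -wz zE -cintZ//=; apply: le_Rintegral => //.
- by case: wfi.
- exact: cintble_normc.
- move=> x _; rewrite (le_trans (ler_norm _))// (le_trans (Re_le_normc _))//.
  by rewrite Normc.normcM w1 mul1r.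
Qed.

End with_measure.
End complex_integral.

Lemma cmeasurable_comp d1 d2 (T1 : measurableType d1) (T2 : measurableType d2)
    (R : realType) (f : T2 -> R[i]) (h : T1 -> T2) :
  cmeasurable f -> measurable_fun setT h -> cmeasurable (fun x => f (h x)).
Proof.
move=> [rf jf] mh; split.
- exact: (measurableT_comp rf mh).
- exact: (measurableT_comp jf mh).
Qed.

(** * Fubini's theorem for complex integrands *)

Section complex_fubini.
Context d1 d2 (T1 : measurableType d1) (T2 : measurableType d2) (R : realType).
Variable m1 : {sigma_finite_measure set T1 -> \bar R}.
Variable m2 : {sigma_finite_measure set T2 -> \bar R}.

(** The inner extended integral may be infinite on a null set, where [fine] turns it into 0; the
    real iterated integrals therefore match [fubini_F] and [fubini_G] only almost everywhere. *)
Lemma Rfubini (f : T1 * T2 -> R) :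
    (m1 \x m2)%E.-integrable setT (fun z => (f z)%:E) ->
  [/\ m1.-integrable setT (fun x => (\int[m2]_y f (x, y))%:E),
      \int[m1]_x \int[m2]_y f (x, y) = \int[(m1 \x m2)%E]_z f z &
      \int[m2]_y \int[m1]_x f (x, y) = \int[(m1 \x m2)%E]_z f z].
Proof.
move=> fi.
have mf : measurable_fun setT f by case/integrableP : (fi) => /measurable_EFinP.
have a1 := ae_integrable1 fi; have a2 := ae_integrable2 fi.
have i1 := integrable_fubini_F fi.
have m1F := measurable_fubini_F fi; have m2G := measurable_fubini_G fi.
have mfin d (T : measurableType d) (h : T -> \bar R) :
    measurable_fun setT h -> measurable_fun setT (fun x => (fine (h x))%:E).
  by move=> mh; apply/measurable_EFinP; apply: measurableT_comp mh => //.
have e1 : ae_eq m1 setT (fubini_F m2 (fun z => (f z)%:E))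
    (fun x => (\int[m2]_y f (x, y))%:E).
  apply: filterS a1 => x xi _; rewrite /Rintegral fineK//.
  exact: integrable_fin_num.
have e2 : ae_eq m2 setT (fubini_G m1 (fun z => (f z)%:E))
    (fun y => (\int[m1]_x f (x, y))%:E).
  apply: filterS a2 => x xi _; rewrite /Rintegral fineK//.
  exact: integrable_fin_num.
have mR1 : measurable_fun setT (fun x => (\int[m2]_y f (x, y))%:E) by exact: mfin.
have mR2 : measurable_fun setT (fun y => (\int[m1]_x f (x, y))%:E) by exact: mfin.
split.
- apply/integrableP; split => //; move/integrableP : i1 => [_].
  rewrite (@ge0_ae_eq_integral _ _ _ _ _ _ (fun x => `|(\int[m2]_y f (x, y))%:E|)%E)//.
  + exact: measurableT_comp.
  + exact: measurableT_comp.
  + by apply: filterS e1 => x /= -> .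
- rewrite [LHS]/Rintegral -(ae_eq_integral _ _ measurableT m1F mR1 e1).
  by rewrite (integral12_prod_meas1 fi).
- rewrite [LHS]/Rintegral -(ae_eq_integral _ _ measurableT m2G mR2 e2).
  by rewrite (integral21_prod_meas1 fi).
Qed.

Lemma cintble_fubini (f : T1 * T2 -> R[i]) : cintble (m1 \x m2)%E f ->
  cintble m1 (fun x => cint m2 (fun y => f (x, y))).
Proof. by move=> [/Rfubini[? _ _] /Rfubini[? _ _]]. Qed.

Lemma cintble_section_ae (f : T1 * T2 -> R[i]) : cintble (m1 \x m2)%E f ->
  {ae m1, forall x, cintble m2 (fun y => f (x, y))}.
Proof. by move=> [/ae_integrable1 + /ae_integrable1]; exact: filterS2. Qed.

Lemma cint_prod1 (f : T1 * T2 -> R[i]) : cintble (m1 \x m2)%E f ->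
  cint m1 (fun x => cint m2 (fun y => f (x, y))) = cint (m1 \x m2)%E f.
Proof. by move=> [/Rfubini[_ ? _] /Rfubini[_ ? _]]; exact: eq_complexP. Qed.

Lemma cint_prod2 (f : T1 * T2 -> R[i]) : cintble (m1 \x m2)%E f ->
  cint m2 (fun y => cint m1 (fun x => f (x, y))) = cint (m1 \x m2)%E f.
Proof. by move=> [/Rfubini[_ _ ?] /Rfubini[_ _ ?]]; exact: eq_complexP. Qed.

Lemma cfubini (f : T1 * T2 -> R[i]) : cintble (m1 \x m2)%E f ->
  cint m1 (fun x => cint m2 (fun y => f (x, y))) =
  cint m2 (fun y => cint m1 (fun x => f (x, y))).
Proof. by move=> fi; rewrite cint_prod1// cint_prod2. Qed.

(** Tonelli, since the modulus of the product factorises. *)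
Lemma cintble_prod (f : T1 -> R[i]) (g : T2 -> R[i]) :
  cintble m1 f -> cintble m2 g ->
  cintble (m1 \x m2)%E (fun z => f z.1 * g z.2).
Proof.
move=> fi gi; have mf := cintble_measurable fi; have mg := cintble_measurable gi.
have mfg : cmeasurable (fun z : T1 * T2 => f z.1 * g z.2).
  by apply: cmeasurableM; apply: cmeasurable_comp.
apply/cintbleP; split => //.
have nf0 (T : Type) (h : T -> R[i]) x : (0 <= (normc (h x))%:E)%E.
  by rewrite lee_fin normc_ge0.
have mn d (T : measurableType d) (h : T -> R[i]) : cmeasurable h ->
    measurable_fun setT (fun x => (normc (h x))%:E).
  by move=> mh; apply/measurable_EFinP; exact: measurable_normc.
have e x : (\int[m2]_y (normc (f x * g y))%:E =
            (normc (f x))%:E * \int[m2]_y (normc (g y))%:E)%E.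
  under eq_integral do rewrite Normc.normcM EFinM.
  by rewrite ge0_integralZl//; exact: mn.
have -> := @fubini_tonelli1 _ _ _ _ _ m1 m2
  (fun z : T1 * T2 => (normc (f z.1 * g z.2))%:E) (mn _ _ _ mfg) (nf0 _ _).
rewrite /fubini_F/=; under eq_integral do rewrite e.
have [_ f1] := (cintbleP _ _).1 fi; have [_ g1] := (cintbleP _ _).1 gi.
have g0 : (0 <= \int[m2]_y (normc (g y))%:E)%E by exact: integral_ge0.
have f0 : (0 <= \int[m1]_y (normc (f y))%:E)%E by exact: integral_ge0.
rewrite ge0_integralZr//; last exact: mn.
by rewrite lte_mul_pinfty// ge0_fin_numE.
Qed.

End complex_fubini.

Section Rintegral_limits.
Context d (T : measurableType d) (R : realType) (mu : {measure set T -> \bar R}).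

Lemma Rdominated_convergence (f_ : nat -> T -> R) (f g : T -> R) :
  (forall n, measurable_fun setT (f_ n)) ->
  (forall x, f_ n x @[n --> \oo] --> f x) ->
  mu.-integrable setT (fun x => (g x)%:E) ->
  (forall n x, `|f_ n x| <= g x) ->
  mu.-integrable setT (fun x => (f x)%:E) /\
  \int[mu]_x f_ n x @[n --> \oo] --> \int[mu]_x f x.
Proof.
move=> mf_ f_f gi fg.
have mfE n : measurable_fun setT (fun x => (f_ n x)%:E) by exact/measurable_EFinP.
have f_fE x : (f_ n x)%:E @[n --> \oo] --> (f x)%:E.
  by apply: cvg_EFin; [exact: nearW|exact: f_f].
have mf : measurable_fun setT (fun x => (f x)%:E).
  by apply: (emeasurable_fun_cvg (fun n x => (f_ n x)%:E)) => // x _; exact: f_fE.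
have fgE : forall x n, (`|(f_ n x)%:E| <= (g x)%:E)%E.
  by move=> x n; rewrite lee_fin.
have [fi _ If] := @dominated_convergence _ _ _ mu setT measurableT
  (fun n x => (f_ n x)%:E) (fun x => (f x)%:E) (fun x => (g x)%:E) mfE mf
  (aeW _ (fun x _ => f_fE x)) gi (aeW _ (fun x n _ => fgE x n)).
split => //; apply: fine_cvg; rewrite /Rintegral fineK//.
exact: (integrable_fin_num measurableT fi).
Qed.

Lemma Rintegrable_le (f g : T -> R) : measurable_fun setT f ->
  mu.-integrable setT (fun x => (g x)%:E) -> (forall x, `|f x| <= g x) ->
  mu.-integrable setT (fun x => (f x)%:E).
Proof.
move=> mf gi fg; apply: (le_integrable measurableT _ _ gi).
  exact/measurable_EFinP.
by move=> x _; rewrite /= lee_fin (le_trans (fg x))// ler_norm.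
Qed.

End Rintegral_limits.

(** * Affine images and products of the Lebesgue measure *)

Section image_measure.
Context d1 d2 (T1 : measurableType d1) (T2 : measurableType d2) (R : realType).
Variables (m1 : {measure set T1 -> \bar R}) (m2 : {measure set T2 -> \bar R}).
Variable h : T1 -> T2.
Hypothesis mh : measurable_fun setT h.
Hypothesis m12 : forall A, measurable A -> m2 A = m1 (h @^-1` A).

Lemma ge0_integral_image (f : T2 -> \bar R) : measurable_fun setT f ->
  (forall y, (0 <= f y)%E) -> (\int[m2]_y f y = \int[m1]_x f (h x))%E.
Proof.
move=> mf f0; apply: eq_trans; last first.
  exact: (@ge0_integral_pushforward _ _ _ _ _ h mh m1 setT f).
by apply: eq_measure_integral => A mA _; exact: m12.
Qed.

Lemma integral_image (f : T2 -> \bar R) : measurable_fun setT f ->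
  m1.-integrable setT (f \o h) -> (\int[m2]_y f y = \int[m1]_x f (h x))%E.
Proof.
move=> mf fi; apply: eq_trans; last first.
  exact: (@integral_pushforward _ _ _ _ _ h mh m1 setT f mf fi measurableT).
by apply: eq_measure_integral => A mA _; exact: m12.
Qed.

End image_measure.

Section lebesgueRn_integral.
Context {R : realType}.
Local Notation tupleR n := (n.-tuple (measurableTypeR R)).
Local Notation lambda :=
  (lebesgue_measure : {sigma_finite_measure set (measurableTypeR R) -> \bar R}).

(** Uniqueness of the Lebesgue measure: [r] times the image measure under [x |-> r x + c] gives each
    half-open interval its length. *)
Lemma lebesgue_measure_affine (r c : R) (A : set R) : 0 < r -> measurable A ->
  (lebesgue_measure ((fun x : R => (r * x + c)%R) @^-1` A) =
   r^-1%:E * lebesgue_measure A)%E.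
Proof.
move=> r0 mA.
pose h : measurableTypeR R -> measurableTypeR R := fun x => r * x + c.
have mh : measurable_fun setT h.
  by apply: measurable_funD => //; exact: measurable_funM.
pose m' := mscale (NngNum (ltW r0)) (pushforward lambda h).
rewrite (_ : lebesgue_measure A = m' mh A).
  by rewrite /m' /mscale/= muleA -EFinM mulVf ?gt_eqF// mul1e.
apply: lebesgue_measure_unique => // _ [[a b]] _ <-.
rewrite [RHS]/(r%:E * lebesgue_measure (h @^-1` `]a, b]%classic))%E.
rewrite (_ : h @^-1` `]a, b]%classic = `](a - c) / r, (b - c) / r]%classic); last first.
  apply/seteqP; split => x /=; rewrite !in_itv/= /h ltr_pdivrMr// ler_pdivlMr//;
  by rewrite ltrBlDr lerBrDr mulrC.
rewrite !lebesgue_measure_itv/= !lte_fin ltr_pM2r ?invr_gt0// ltrD2r.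
case: (a < b); last by rewrite /= mulr0.
by rewrite /= -EFinB -mulrBl mulrC divfK ?gt_eqF//; congr (_%:E); lra.
Qed.

Lemma measurable_affine1 (r c : R) :
  measurable_fun setT ((fun x => r * x + c) : measurableTypeR R -> measurableTypeR R).
Proof. by apply: measurable_funD => //; exact: measurable_funM. Qed.

Lemma ge0_integral_affine1 (r c : R) (f : measurableTypeR R -> \bar R) :
  0 < r -> measurable_fun setT f -> (forall x, (0 <= f x)%E) ->
  (\int[lambda]_x f (r * x + c)%R = r^-1%:E * \int[lambda]_x f x)%E.
Proof.
move=> r0 mf f0.
have ri0 : 0 <= r^-1 by rewrite invr_ge0 ltW.
pose h : measurableTypeR R -> measurableTypeR R := fun x => r * x + c.
have mh : measurable_fun setT h.
  by apply: measurable_funD => //; exact: measurable_funM.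
rewrite -(@ge0_integral_mscale _ _ _ _ _ measurableT (NngNum ri0))//.
apply/esym; apply: (ge0_integral_image mh) => // A mA.
apply/esym; exact: lebesgue_measure_affine.
Qed.

Lemma measurable_fun_consR n d (U : measurableType d) (f : tupleR n.+1 -> U) :
  measurable_fun setT f -> measurable_fun setT (f \o @consR R n).
Proof. by move=> mf; apply: measurableT_comp => //; exact: measurable_consR. Qed.

Lemma ge0_integral_lebesgueRnS n (f : tupleR n.+1 -> \bar R) :
  measurable_fun setT f -> (forall t, (0 <= f t)%E) ->
  (\int[lebesgueRn R n.+1]_t f t =
   \int[(lambda \x lebesgueRn R n)%E]_p f (consR p))%E.
Proof.
move=> mf f0.
exact: (ge0_integral_image (@measurable_consR R n)).
Qed.

Lemma cint_lebesgueRnS n (f : tupleR n.+1 -> R[i]) : cmeasurable f ->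
    cintble (lambda \x lebesgueRn R n)%E (f \o @consR R n) ->
  cintble (lebesgueRn R n.+1) f /\
  cint (lebesgueRn R n.+1) f = cint (lambda \x lebesgueRn R n)%E (f \o @consR R n).
Proof.
move=> mf fi; split.
  apply/cintbleP; split => //.
  rewrite ge0_integral_lebesgueRnS.
  - by have /cintbleP[_] := fi.
  - by apply/measurable_EFinP; exact: measurable_normc.
  - by move=> t; rewrite lee_fin normc_ge0.
have H (g : tupleR n.+1 -> R) : measurable_fun setT g ->
    (lambda \x lebesgueRn R n)%E.-integrable setT (fun x => (g (consR x))%:E) ->
    \int[lebesgueRn R n.+1]_x g x = \int[(lambda \x lebesgueRn R n)%E]_x g (consR x).
  move=> mg gi; congr fine.
  have mgE : measurable_fun setT (fun t => (g t)%:E) by exact/measurable_EFinP.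
  exact: (integral_image (@measurable_consR R n)).
case: fi => ri ji; case: mf => rf jf.
by apply: eq_complexP; rewrite /= H.
Qed.

(** The map [x |-> r x + v] transported to tuples, where the measure lives. *)
Definition afft n (r : R) (v : 'rV[R]_n) (t : tupleR n) : tupleR n :=
  [tuple r * tnth t i + v ord0 i | i < n].

Lemma rowv_afft n (r : R) (v : 'rV[R]_n) t :
  rowv (afft r v t) = r *: rowv t + v.
Proof. by apply/rowP => i; rewrite !mxE tnth_mktuple. Qed.

Lemma measurable_afft n r (v : 'rV[R]_n) : measurable_fun setT (afft r v).
Proof.
apply/measurable_fun_tnthP => i; rewrite /comp.
under eq_fun do rewrite tnth_mktuple.
apply: measurable_funD => //; apply: measurable_funM => //.
exact: measurable_tnth.
Qed.

Lemma afft_consR n r (v : 'rV[R]_n.+1) (x : measurableTypeR R) (t : tupleR n) :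
  afft r v (consR (x, t)) =
  consR (r * x + v ord0 ord0,
    afft r (\row_i v ord0 (lift ord0 i)) t).
Proof.
apply/eq_from_tnth => i; rewrite tnth_mktuple.
have [j ->|->] := unliftP ord0 i.
  by rewrite /consR/= !tnthS tnth_mktuple mxE.
by rewrite /consR/= !tnth0.
Qed.

(** Induction on the dimension: Tonelli splits off the first coordinate, whose affine substitution
    contributes one factor [r^-1]. *)
Lemma ge0_integral_afft n (r : R) (v : 'rV[R]_n) (f : tupleR n -> \bar R) :
  0 < r -> measurable_fun setT f -> (forall x, (0 <= f x)%E) ->
  (\int[lebesgueRn R n]_t f (afft r v t) =
   (r ^- n)%:E * \int[lebesgueRn R n]_t f t)%E.
Proof.
move=> r0; elim: n => [|n ih] in v f * => mf f0.
  rewrite expr0 invr1 mul1e; apply: eq_integral => t _.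
  by rewrite (tuple0 t) (tuple0 (afft _ _ _)).
have mfa : measurable_fun setT (fun t => f (afft r v t)).
  by apply: measurableT_comp => //; exact: measurable_afft.
have mfc := measurable_fun_consR mf.
rewrite ge0_integral_lebesgueRnS// ge0_integral_lebesgueRnS//.
have -> := @fubini_tonelli1 _ _ _ _ _ lambda (lebesgueRn R n)
  (fun p => f (afft r v (consR p))) (measurable_fun_consR mfa)
  (fun p => f0 (afft r v (consR p))).
have -> := @fubini_tonelli1 _ _ _ _ _ lambda (lebesgueRn R n)
  (fun p => f (consR p)) mfc (fun p => f0 (consR p)).
rewrite /fubini_F/=.
pose F x := (\int[lebesgueRn R n]_t f (consR (x, t)))%E.
have mF : measurable_fun setT F.
  exact: (@measurable_fun_fubini_tonelli_F _ _ _ _ _ (lebesgueRn R n)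
    (fun p => f (consR p)) mfc (fun p => f0 (consR p))).
have F0 x : (0 <= F x)%E by exact: integral_ge0.
transitivity (\int[lambda]_x ((r ^- n)%:E * F (r * x + v ord0 ord0)%R))%E.
  apply: eq_integral => x _; under eq_integral do rewrite afft_consR.
  rewrite (ih _ (fun t => f (consR (_, t))))//.
  exact: (measurableT_comp mfc (measurable_pair1 _)).
rewrite ge0_integralZl; first last.
- by rewrite lee_fin invr_ge0 exprn_ge0// ltW.
- by move=> x _; exact: F0.
- by apply: measurableT_comp mF _; exact: measurable_affine1.
- exact: measurableT.
by rewrite ge0_integral_affine1// muleA -EFinM -invfM -exprSr.
Qed.

Lemma integral_afft n (r : R) (v : 'rV[R]_n) (f : tupleR n -> R) :
  0 < r -> (lebesgueRn R n).-integrable setT (fun t => (f t)%:E) ->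
  (lebesgueRn R n).-integrable setT (fun t => (f (afft r v t))%:E) /\
  \int[lebesgueRn R n]_t f (afft r v t) =
  r ^- n * \int[lebesgueRn R n]_t f t.
Proof.
move=> r0 fi.
have rn0 : 0 <= r ^- n by rewrite invr_ge0 exprn_ge0// ltW.
have mf : measurable_fun setT (fun t => (f t)%:E) by exact: measurable_int fi.
have fai : (lebesgueRn R n).-integrable setT (fun t => (f (afft r v t))%:E).
  apply/integrableP; split.
    by apply: (measurableT_comp mf); exact: measurable_afft.
  rewrite (@ge0_integral_afft n r v (fun t => `|(f t)%:E|%E))//; last first.
    exact: measurableT_comp.
  by rewrite lte_mul_pinfty// ?lee_fin//; have /integrableP[] := fi.
split => //.
rewrite /Rintegral -[X in X * _]/(fine (r ^- n)%:E).
rewrite -fineM//; last exact: integrable_fin_num.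
congr fine; rewrite integralE [in RHS]integralE.
rewrite (funepos_comp (fun t => (f t)%:E) (afft r v)).
rewrite (funeneg_comp (fun t => (f t)%:E) (afft r v)).
rewrite (ge0_integral_afft v r0 (measurable_funepos mf))//.
rewrite (ge0_integral_afft v r0 (measurable_funeneg mf))//.
by rewrite -muleBr//; apply: fin_num_adde_defl; rewrite fin_numN;
  exact: integrable_neg_fin_num.
Qed.

Lemma cint_afft n (r : R) (v : 'rV[R]_n) (f : tupleR n -> R[i]) : 0 < r ->
  cintble (lebesgueRn R n) f ->
  cintble (lebesgueRn R n) (fun t => f (afft r v t)) /\
  cint (lebesgueRn R n) (fun t => f (afft r v t)) =
  (r ^- n)%:C * cint (lebesgueRn R n) f.
Proof.
move=> r0 [ri ji]; have [ri' rE] := integral_afft v r0 ri.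
have [ji' jE] := integral_afft v r0 ji.
split; first by split.
by apply: eq_complexP; rewrite ?ReM ?ImM /= ?mul0r ?subr0 ?addr0.
Qed.

(** Induction on [n] with Fubini; in dimension 0 the measure is a Dirac mass, so the empty product
    integrates to 1. This reduces the n-dimensional Gaussian integrals to the line. *)
Lemma cint_tensor n (F : 'I_n -> measurableTypeR R -> R[i]) :
  (forall i, cintble lambda (F i)) ->
  cintble (lebesgueRn R n) (fun t => \prod_i F i (tnth t i)) /\
  cint (lebesgueRn R n) (fun t => \prod_i F i (tnth t i)) =
  \prod_i cint lambda (F i).
Proof.
elim: n F => [|n ih] F Fi.
  under eq_fun do rewrite big_ord0.
  rewrite big_ord0; split.
    split; exact: (finite_measure_integrable_cst (\d_ [tuple])).
  apply: eq_complexP; rewrite /= (Rintegral_cst (lebesgueRn R 0)) ?mul0r//.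
  rewrite mul1r -[RHS]/(fine 1); congr fine.
  exact: (@diracT _ _ R ([tuple] : tupleR 0)).
have [Gi GE] := ih (fun i => F (lift ord0 i)) (fun i => Fi _).
have FG : (fun t => \prod_(i < n.+1) F i (tnth t i)) \o @consR R n =
    (fun z => F ord0 z.1 * \prod_(i < n) F (lift ord0 i) (tnth z.2 i)).
  apply/funext => -[x t]; rewrite /= big_ord_recl /consR tnth0/=.
  by congr (_ * _); apply: eq_bigr => i _; rewrite tnthS.
have mF : cmeasurable (fun t : tupleR n.+1 => \prod_i F i (tnth t i)).
  rewrite unlock; elim: (index_enum _) => /= [|i s ihs].
    exact: cmeasurable_cst.
  apply: cmeasurableM => //.
  apply: (cmeasurable_comp (h := fun t : tupleR n.+1 => tnth t i)).
    exact: cintble_measurable (Fi i).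
  exact: measurable_tnth.
have prodi := cintble_prod (Fi ord0) Gi.
have := cint_lebesgueRnS mF; rewrite FG => /(_ prodi)[? ->]; split => //.
rewrite big_ord_recl -GE -cint_prod1//=.
under [X in cint _ X]eq_fun do rewrite cintZ//.
under [X in cint _ X]eq_fun do rewrite mulrC.
by rewrite cintZ// mulrC.
Qed.

End lebesgueRn_integral.

(** * Fourier integrals of one-dimensional Gaussians *)

Section gauss1.
Context {R : realType}.
Local Notation lambda :=
  (lebesgue_measure : {sigma_finite_measure set (measurableTypeR R) -> \bar R}).

(** [r] is the inverse of the width; in this scaling the Fourier integral of [gauss r] is a multiple
    of [gauss r^-1]. *)
Definition gauss (r x : R) : R := expR (- ((r * x) ^+ 2 / 2)).

Lemma gauss_ge0 r x : 0 <= gauss r x. Proof. exact: expR_ge0. Qed.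

Lemma measurable_gauss r : measurable_fun setT (gauss r).
Proof.
apply: measurableT_comp => //; apply: measurable_funN.
by apply: measurable_funM => //; apply: measurable_funX; exact: measurable_funM.
Qed.

Lemma integrable_gauss (r : R) : 0 < r ->
  lambda.-integrable setT (fun x => (gauss r x)%:E) /\
  (\int[lambda]_x gauss r x = Num.sqrt (2 * pi) / r)%R.
Proof.
(* The known integral is that of [gauss_fun x = exp (- x^2)], equal to [sqrt pi]; [a] is the slope
   of the substitution that leads to it. *)
move=> r0; pose a := r / Num.sqrt 2.
have s20 : 0 < Num.sqrt 2 :> R by rewrite sqrtr_gt0.
have a0 : 0 < a by rewrite divr_gt0.
have gE x : gauss r x = gauss_fun (a * x + 0).
  rewrite /gauss /gauss_fun addr0 /a; congr expR; congr (- _).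
  by rewrite !exprMn exprVn sqr_sqrtr// mulrAC.
have E : (\int[lambda]_x (gauss r x)%:E = (Num.sqrt (2 * pi) / r)%:E)%E.
  under eq_integral do rewrite gE.
  rewrite (@ge0_integral_affine1 _ a 0 (fun x => (gauss_fun x)%:E))//.
  - have := @integralT_gauss R; rewrite /= => ->; rewrite -EFinM; congr EFin.
    by rewrite sqrtrM// /a invf_div mulrC mulrA (mulrC (Num.sqrt pi)).
  - by apply/measurable_EFinP; exact: measurable_gauss_fun.
  - by move=> x; rewrite lee_fin gauss_fun_ge0.
split; last by rewrite /Rintegral E.
apply/integrableP; split; first by apply/measurable_EFinP; exact: measurable_gauss.
under eq_integral do rewrite /= ger0_norm ?gauss_ge0//.
by rewrite E ltry.
Qed.

(** Half of the exponent, [t = (r x)^2 / 4], absorbs [x^2] through [t <= exp t]; the other half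
    survives as a wider Gaussian. *)
Lemma sqrM_gauss_le (r x : R) : 0 < r ->
  x ^+ 2 * gauss r x <= 4 / r ^+ 2 * gauss (r / Num.sqrt 2) x.
Proof.
move=> r0; have s20 : Num.sqrt 2 != 0 :> R by rewrite gt_eqF// sqrtr_gt0.
pose t := (r * x) ^+ 2 / 4.
have -> : gauss r x = expR (- t) * gauss (r / Num.sqrt 2) x.
  rewrite /gauss -expRD; congr expR.
  by rewrite /t !exprMn exprVn sqr_sqrtr//; field.
rewrite mulrA ler_wpM2r ?gauss_ge0//.
rewrite expRN ler_pdivrMr ?expR_gt0//.
have -> : x ^+ 2 = 4 / r ^+ 2 * t by rewrite /t exprMn; field; exact: lt0r_neq0.
rewrite ler_wpM2l ?divr_ge0 ?sqr_ge0//.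
by rewrite (le_trans _ (expR_ge1Dx t))// lerDr.
Qed.

Lemma integrable_sqrM_gauss (r : R) : 0 < r ->
  lambda.-integrable setT (fun x => (x ^+ 2 * gauss r x)%:E).
Proof.
move=> r0.
have r'0 : 0 < r / Num.sqrt 2 by rewrite divr_gt0// sqrtr_gt0.
apply: (@Rintegrable_le _ _ R lambda (fun x => x ^+ 2 * gauss r x)
  (fun x => 4 / r ^+ 2 * gauss (r / Num.sqrt 2) x)).
- apply: measurable_funM; first exact: measurable_funX.
  exact: measurable_gauss.
- under eq_fun do rewrite EFinM.
  by apply: integrableZl => //; exact: (integrable_gauss r'0).1.
- move=> x; rewrite ger0_norm ?sqrM_gauss_le//.
  by rewrite mulr_ge0 ?gauss_ge0// sqr_ge0.
Qed.

Lemma integrable_Mgauss (r : R) (p : R -> R) : 0 < r -> measurable_fun setT p ->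
  (forall x, `|p x| <= 1 + x ^+ 2) ->
  lambda.-integrable setT (fun x => (p x * gauss r x)%:E).
Proof.
move=> r0 mp pb.
apply: (@Rintegrable_le _ _ R lambda (fun x => p x * gauss r x)
  (fun x => gauss r x + x ^+ 2 * gauss r x)).
- by apply: measurable_funM => //; exact: measurable_gauss.
- under eq_fun do rewrite EFinD; apply: integrableD => //.
    exact: (integrable_gauss r0).1.
  exact: integrable_sqrM_gauss.
- move=> x; rewrite -{2}[gauss r x]mul1r -mulrDl.
  by rewrite normrM (ger0_norm (gauss_ge0 _ _)) ler_wpM2r ?gauss_ge0.
Qed.

(** The fundamental theorem of calculus on [[-n, n]], then dominated convergence: an integration by
    parts without boundary terms. *)
Lemma integral_derive_eq0 (F f : R -> R) :
  (forall x : R, is_derive x (1 : R) F (f x)) -> continuous f ->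
  lambda.-integrable setT (fun x => (f x)%:E) ->
  F n%:R @[n --> \oo] --> 0 -> F (- n%:R) @[n --> \oo] --> 0 ->
  \int[lambda]_x f x = 0.
Proof.
move=> dF cf fi Fp Fn.
have mf : measurable_fun setT f by exact: continuous_measurable_fun.
pose f_ n x := f x * \1_(`[- n%:R, n%:R]) x.
have mf_ n : measurable_fun setT (f_ n) by apply: measurable_funM.
have f_f x : f_ n x @[n --> \oo] --> f x.
  apply: cvg_near_cst; near=> n.
  rewrite /f_ indicE mem_set ?mulr1//= in_itv/= -ler_norml.
  near: n; exact: nbhs_infty_ger.
have f_le n x : `|f_ n x| <= `|f x|.
  by rewrite normrM ler_piMr// indicE; case: (_ \in _); rewrite ?normr1 ?normr0.
have [_ cI] := @Rdominated_convergence _ _ _ lambda f_ f (fun x => `|f x|)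
  mf_ f_f (integrable_norm fi) f_le.
have cF : continuous F.
  by move=> x; apply: differentiable_continuous; apply/derivable1_diffP.
(* The shift to [n.+1] keeps the interval nondegenerate, as [continuous_FTC2] demands. *)
have IE n : \int[lambda]_x f_ n.+1 x = F n.+1%:R - F (- n.+1%:R).
  rewrite -[RHS]/(fine ((F n.+1%:R)%:E - (F (- n.+1%:R))%:E)).
  rewrite -(@continuous_FTC2 _ f F (- n.+1%:R) n.+1%:R)//; last 4 first.
  - by rewrite (@lt_trans _ _ 0)// oppr_lt0.
  - exact: continuous_subspaceT.
  - split => [x _| |]; first exact: ex_derive.
    + by apply: cvg_at_right_filter; exact: cF.
    + by apply: cvg_at_left_filter; exact: cF.
  - by move=> x _; rewrite derive1E; exact: derive_val.
  rewrite [in RHS]integral_mkcond; congr fine; apply: eq_integral => x _.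
  by rewrite /f_ patchE indicE; case: (x \in _); rewrite ?mulr1 ?mulr0.
have IF0 : \int[lambda]_x f_ n x @[n --> \oo] --> (0 : R).
  rewrite -(cvg_shiftS _); under eq_fun do rewrite IE.
  have Fp' : F n.+1%:R @[n --> \oo] --> (0 : R).
    by rewrite (cvg_shiftS (fun n => F n%:R)).
  have Fn' : F (- n.+1%:R) @[n --> \oo] --> (0 : R).
    by rewrite (cvg_shiftS (fun n => F (- n%:R))).
  have H := cvgB Fp' Fn'; rewrite subrr in H; exact: H.
exact: (cvg_unique _ cI IF0).
Unshelve. all: end_near. Qed.

Lemma gauss_cvg0 (r : R) (F : R -> R) : 0 < r ->
  (forall x, `|F x| <= (1 + `|x|) * gauss r x) ->
  F n%:R @[n --> \oo] --> 0 /\ F (- n%:R) @[n --> \oo] --> 0.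
Proof.
move=> r0 Fle.
have xg (x : R) : x ^+ 2 * gauss r x <= 2 / r ^+ 2.
  rewrite /gauss expRN ler_pdivrMr ?expR_gt0//.
  rewrite (_ : x ^+ 2 = 2 / r ^+ 2 * ((r * x) ^+ 2 / 2)); last first.
    by rewrite exprMn; field; exact: lt0r_neq0.
  rewrite ler_wpM2l ?divr_ge0 ?sqr_ge0//.
  by rewrite (le_trans _ (expR_ge1Dx _))// lerDr.
(* For [|x| >= 1] one has [(1 + |x|) |x| <= 2 x^2]; with the bound [xg] on [x^2 gauss r x] this
   gives the constant 4. *)
have Fb (x : R) n : `|x| = n.+1%:R -> `|F x| <= 4 / r ^+ 2 * n.+1%:R^-1.
  move=> xn; rewrite (le_trans (Fle x))// ler_pdivlMr ?ltr0n//.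
  have x1 : 1 <= `|x| by rewrite xn ler1n.
  rewrite -xn mulrAC (@le_trans _ _ (2 * x ^+ 2 * gauss r x))//.
    rewrite ler_wpM2r ?gauss_ge0// -(real_normK (num_real x)); nra.
  by have := xg x; rewrite -mulrA; lra.
have c0 : 4 / r ^+ 2 * n.+1%:R^-1 @[n --> \oo] --> (0 : R).
  have H := cvgM (cvg_cst (4 / r ^+ 2)) (@cvg_harmonic R).
  rewrite mulr0 in H; exact: H.
split; rewrite -(cvg_shiftS _); apply: norm_cvg0;
  apply: (@squeeze_cvgr _ _ _ _ (cst 0) _ _ _ _ (cvg_cst 0) c0);
  apply: nearW => n; rewrite normr_ge0/=; apply: Fb.
- by rewrite ger0_norm.
- by rewrite normrN ger0_norm.
Qed.

Lemma is_derive_gauss (r x : R) :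
  is_derive x (1 : R) (gauss r) (- r ^+ 2 * x * gauss r x).
Proof.
have -> : gauss r = expR \o (cst (- (r ^+ 2 / 2)) * (id ^+ 2)).
  by apply/funext => y; rewrite /gauss /= exprMn mulrAC mulNr.
by apply: is_derive_eq; rewrite scaler0 addr0 expr1 !fctE /GRing.scale/=; field.
Qed.

Lemma is_derive_cosM (t x : R) :
  is_derive x (1 : R) (fun y => cos (t * y)) (- t * sin (t * x)).
Proof.
have -> : (fun y => cos (t * y)) = cos \o (cst t * id) by [].
apply: is_derive_eq; rewrite !fctE scaler0 addr0 /GRing.scale/=; ring.
Qed.

Lemma is_derive_sinM (t x : R) :
  is_derive x (1 : R) (fun y => sin (t * y)) (t * cos (t * x)).
Proof.
have -> : (fun y => sin (t * y)) = sin \o (cst t * id) by [].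
apply: is_derive_eq; rewrite !fctE scaler0 addr0 /GRing.scale/=; ring.
Qed.

Lemma continuous_gauss r : continuous (gauss r).
Proof.
move=> x; apply: differentiable_continuous; apply/derivable1_diffP.
by have [] := is_derive_gauss r x.
Qed.

Lemma continuous_cosM (t : R) : continuous (fun y => cos (t * y)).
Proof.
move=> x; apply: differentiable_continuous; apply/derivable1_diffP.
by have [] := is_derive_cosM t x.
Qed.

Lemma continuous_sinM (t : R) : continuous (fun y => sin (t * y)).
Proof.
move=> x; apply: differentiable_continuous; apply/derivable1_diffP.
by have [] := is_derive_sinM t x.
Qed.

Lemma measurable_cosM (t : R) : measurable_fun setT (fun y => cos (t * y)).
Proof. by apply: continuous_measurable_fun; exact: continuous_cosM. Qed.

Lemma measurable_sinM (t : R) : measurable_fun setT (fun y => sin (t * y)).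
Proof. by apply: continuous_measurable_fun; exact: continuous_sinM. Qed.

Let RintegralL (a b : R) (f g : R -> R) :
  lambda.-integrable setT (fun x => (f x)%:E) ->
  lambda.-integrable setT (fun x => (g x)%:E) ->
  lambda.-integrable setT (fun x => (a * f x + b * g x)%:E) /\
  \int[lambda]_x (a * f x + b * g x) =
  a * \int[lambda]_x f x + b * \int[lambda]_x g x.
Proof.
move=> fi gi.
have afi : lambda.-integrable setT (fun x => (a * f x)%:E).
  by under eq_fun do rewrite EFinM; exact: integrableZl.
have bgi : lambda.-integrable setT (fun x => (b * g x)%:E).
  by under eq_fun do rewrite EFinM; exact: integrableZl.
split; first by under eq_fun do rewrite EFinD; exact: integrableD.
by rewrite RintegralD// !RintegralZl.
Qed.

(** The factor 1 comes from applying [RintegralL] twice; the identities [E], [rE] and [iE] below are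
    written to match this shape. *)
Let RintegralL3 (a b c : R) (f g h : R -> R) :
  lambda.-integrable setT (fun x => (f x)%:E) ->
  lambda.-integrable setT (fun x => (g x)%:E) ->
  lambda.-integrable setT (fun x => (h x)%:E) ->
  lambda.-integrable setT (fun x => (1 * (a * f x + b * g x) + c * h x)%:E) /\
  \int[lambda]_x (1 * (a * f x + b * g x) + c * h x) =
  a * \int[lambda]_x f x + b * \int[lambda]_x g x + c * \int[lambda]_x h x.
Proof.
move=> fi gi hi; have [i e] := RintegralL a b fi gi.
by have [? ->] := RintegralL 1 c i hi; rewrite e mul1r.
Qed.

Section moments.
Variables (r : R) (r0 : 0 < r).

(** Together with [gsin], the real and imaginary parts of the moments of [e^{i t x} gauss r x].
    Orders up to 2 suffice, because the Laplacian brings down at most two powers of [x]. *)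
Definition gcos k t := \int[lambda]_x (x ^+ k * cos (t * x) * gauss r x).
Definition gsin k t := \int[lambda]_x (x ^+ k * sin (t * x) * gauss r x).

Let normX_le k (x : R) : (k <= 2)%N -> `|x ^+ k| <= 1 + x ^+ 2.
Proof.
rewrite normrX; move: k => [|[|[|//]]] _.
- by rewrite expr0 lerDl sqr_ge0.
- rewrite -(real_normK (num_real x)); nra.
- by rewrite real_normK ?num_real// lerDr.
Qed.

Let normXM_le k (x c : R) : (k <= 2)%N -> `|c| <= 1 -> `|x ^+ k * c| <= 1 + x ^+ 2.
Proof.
move=> k2 c1; rewrite normrM -[leRHS]mulr1 ler_pM//; exact: normX_le.
Qed.

Lemma integrable_gcos k t : (k <= 2)%N ->
  lambda.-integrable setT (fun x => (x ^+ k * cos (t * x) * gauss r x)%:E).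
Proof.
move=> k2; apply: (@integrable_Mgauss r (fun x => x ^+ k * cos (t * x))) => //.
  by apply: measurable_funM; [exact: measurable_funX|exact: measurable_cosM].
by move=> x; apply: normXM_le => //; rewrite ler_norml cos_le1 cos_geN1.
Qed.

Lemma integrable_gsin k t : (k <= 2)%N ->
  lambda.-integrable setT (fun x => (x ^+ k * sin (t * x) * gauss r x)%:E).
Proof.
move=> k2; apply: (@integrable_Mgauss r (fun x => x ^+ k * sin (t * x))) => //.
  by apply: measurable_funM; [exact: measurable_funX|exact: measurable_sinM].
by move=> x; apply: normXM_le => //; rewrite ler_norml sin_le1 sin_geN1.
Qed.

(** The integrand is the derivative of [p * gauss r]. Taking [p] to be [sin], [cos], [x cos] and
    [x sin] of [t x] yields the four recurrences below. *)
Let gibp (p p' : R -> R) :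
    (forall x : R, is_derive x (1 : R) p (p' x)) -> continuous p' ->
    (forall x, `|p x| <= 1 + `|x|) ->
    lambda.-integrable setT (fun x => ((p' x - r ^+ 2 * x * p x) * gauss r x)%:E) ->
  \int[lambda]_x ((p' x - r ^+ 2 * x * p x) * gauss r x) = 0.
Proof.
move=> dp cp' pb pi.
have cp : continuous p.
  move=> x; apply: differentiable_continuous; apply/derivable1_diffP.
  by have [] := dp x.
have pg x : `|(p * gauss r) x| <= (1 + `|x|) * gauss r x.
  by rewrite normrM (ger0_norm (gauss_ge0 _ _)) ler_wpM2r ?gauss_ge0.
have [c1 c2] := @gauss_cvg0 r (p * gauss r) r0 pg.
apply: (@integral_derive_eq0 (p * gauss r)) => //.
- move=> x; apply: (is_derive_eq (is_deriveM (dp x) (is_derive_gauss r x))).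
  rewrite /GRing.scale/=; ring.
- move=> x; apply: cvgM; last exact: continuous_gauss.
  apply: cvgB; first exact: cp'.
  by apply: cvgM; [apply: cvgM; [exact: cvg_cst|exact: cvg_id]|exact: cp].
Qed.

Let trig_le1 (y : R) : `|cos y| <= 1 /\ `|sin y| <= 1.
Proof. by rewrite !ler_norml cos_le1 cos_geN1 sin_le1 sin_geN1. Qed.

Lemma gsin1 t : r ^+ 2 * gsin 1 t = t * gcos 0 t.
Proof.
have [i e] := RintegralL t (- r ^+ 2) (integrable_gcos t (isT : 0 <= 2)%N)
  (integrable_gsin t (isT : 1 <= 2)%N).
have E x : t * (x ^+ 0 * cos (t * x) * gauss r x) +
   - r ^+ 2 * (x ^+ 1 * sin (t * x) * gauss r x) =
   (t * cos (t * x) - r ^+ 2 * x * sin (t * x)) * gauss r x by ring.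
have := @gibp _ _ (is_derive_sinM t) _ _ _.
under eq_Rintegral do rewrite -E.
rewrite e => H; apply/esym/eqP; rewrite -subr_eq0 -mulNr -[X in _ == X]H//.
- by move=> x; apply: cvgM; [exact: cvg_cst|exact: continuous_cosM].
- by move=> x; rewrite (le_trans (trig_le1 _).2)// lerDl.
- by under eq_fun do rewrite -E.
Qed.

Lemma gcos1 t : r ^+ 2 * gcos 1 t = - t * gsin 0 t.
Proof.
have [i e] := RintegralL (- t) (- r ^+ 2) (integrable_gsin t (isT : 0 <= 2)%N)
  (integrable_gcos t (isT : 1 <= 2)%N).
have E x : - t * (x ^+ 0 * sin (t * x) * gauss r x) +
   - r ^+ 2 * (x ^+ 1 * cos (t * x) * gauss r x) =
   (- t * sin (t * x) - r ^+ 2 * x * cos (t * x)) * gauss r x by ring.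
have := @gibp _ _ (is_derive_cosM t) _ _ _.
under eq_Rintegral do rewrite -E.
rewrite e => H; apply/esym/eqP; rewrite -subr_eq0 -mulNr -[X in _ == X]H//.
- by move=> x; apply: cvgM; [exact: cvg_cst|exact: continuous_sinM].
- by move=> x; rewrite (le_trans (trig_le1 _).1)// lerDl.
- by under eq_fun do rewrite -E.
Qed.

Lemma gcos2 t : r ^+ 2 * gcos 2 t = gcos 0 t - t * gsin 1 t.
Proof.
have [i e] := RintegralL3 1 (- t) (- r ^+ 2) (integrable_gcos t (isT : 0 <= 2)%N)
  (integrable_gsin t (isT : 1 <= 2)%N) (integrable_gcos t (isT : 2 <= 2)%N).
have E x : 1 * (1 * (x ^+ 0 * cos (t * x) * gauss r x) +
   - t * (x ^+ 1 * sin (t * x) * gauss r x)) +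
   - r ^+ 2 * (x ^+ 2 * cos (t * x) * gauss r x) =
   ((cos (t * x) + x * (- t * sin (t * x))) - r ^+ 2 * x * (x * cos (t * x)))
   * gauss r x by ring.
have dxcos (x : R) : is_derive x (1 : R) (fun x => x * cos (t * x))
    (cos (t * x) + x * (- t * sin (t * x))).
  apply: (is_derive_eq (is_deriveM (is_derive_id x 1) (is_derive_cosM t x))).
  rewrite /GRing.scale/=; ring.
have := @gibp _ _ dxcos _ _ _.
under eq_Rintegral do rewrite -E.
rewrite e => H; apply/esym/eqP; rewrite -subr_eq0.
rewrite -[X in _ == X]H//; first by apply/eqP; rewrite /gcos /gsin; ring.
- move=> x; apply: cvgD; first exact: continuous_cosM.
  apply: cvgM; first exact: cvg_id.
  by apply: cvgM; [exact: cvg_cst|exact: continuous_sinM].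
- move=> x; rewrite normrM (@le_trans _ _ `|x|) ?lerDr//.
  by rewrite ler_piMr//; exact: (trig_le1 _).1.
- by under eq_fun do rewrite -E.
Qed.

Lemma gsin2 t : r ^+ 2 * gsin 2 t = gsin 0 t + t * gcos 1 t.
Proof.
have [i e] := RintegralL3 1 t (- r ^+ 2) (integrable_gsin t (isT : 0 <= 2)%N)
  (integrable_gcos t (isT : 1 <= 2)%N) (integrable_gsin t (isT : 2 <= 2)%N).
have E x : 1 * (1 * (x ^+ 0 * sin (t * x) * gauss r x) +
   t * (x ^+ 1 * cos (t * x) * gauss r x)) +
   - r ^+ 2 * (x ^+ 2 * sin (t * x) * gauss r x) =
   ((sin (t * x) + x * (t * cos (t * x))) - r ^+ 2 * x * (x * sin (t * x)))
   * gauss r x by ring.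
have dxsin (x : R) : is_derive x (1 : R) (fun x => x * sin (t * x))
    (sin (t * x) + x * (t * cos (t * x))).
  apply: (is_derive_eq (is_deriveM (is_derive_id x 1) (is_derive_sinM t x))).
  rewrite /GRing.scale/=; ring.
have := @gibp _ _ dxsin _ _ _.
under eq_Rintegral do rewrite -E.
rewrite e => H; apply/esym/eqP; rewrite -subr_eq0.
rewrite -[X in _ == X]H//; first by apply/eqP; rewrite /gcos /gsin; ring.
- move=> x; apply: cvgD; first exact: continuous_sinM.
  apply: cvgM; first exact: cvg_id.
  by apply: cvgM; [exact: cvg_cst|exact: continuous_cosM].
- move=> x; rewrite normrM (@le_trans _ _ `|x|) ?lerDr//.
  by rewrite ler_piMr//; exact: (trig_le1 _).2.
- by under eq_fun do rewrite -E.
Qed.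

Let integrable_normM_gauss :
  lambda.-integrable setT (fun x => (`|x| * gauss r x)%:E).
Proof.
apply: integrable_Mgauss => //.
by move=> x; rewrite normr_id; have := @normX_le 1 x isT; rewrite expr1.
Qed.

(** Differentiation under the integral sign; the dominating function does not depend on [u], so any
    window around [t] serves. *)
Let gderive (F F' : R -> R -> R) t :
  (forall u, lambda.-integrable setT (fun x => (F u x)%:E)) ->
  (forall u x : R, is_derive u (1 : R) (F ^~ x) (F' u x)) ->
  (forall u x, `|F' u x| <= `|x| * gauss r x) ->
  is_derive t (1 : R) (fun u => \int[lambda]_x F u x) (\int[lambda]_x F' t x).
Proof.
move=> Fi dF F'le.
have It : `]t - 1, t + 1[%classic t.
  by rewrite /= in_itv/= ltrBlDr !ltrDl ltr01.
have pE u x : partial1of2 F u x = F' u x.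
  by rewrite partial1of2E; have [_ ->] := dF u x.
have Gub u x : `]t - 1, t + 1[%classic u -> setT x ->
    `|partial1of2 F u x| <= `|x| * gauss r x.
  by move=> _ _; rewrite pE.
have dF1 u x : `]t - 1, t + 1[%classic u -> setT x -> derivable (F ^~ x) u 1.
  by move=> _ _; have [] := dF u x.
have G0 x : 0 <= `|x| * gauss r x by rewrite mulr_ge0// gauss_ge0.
have D1 := @derivable_under_integral R _ _ lambda F setT measurableT t (t - 1)
  (t + 1) It (fun u _ => Fi u) dF1 _ G0 integrable_normM_gauss Gub.
have D2 := @differentiation_under_integral R _ _ lambda F setT measurableT t (t - 1)
  (t + 1) It (fun u _ => Fi u) dF1 _ G0 integrable_normM_gauss Gub.
apply: DeriveDef => //; rewrite -derive1E D2.
by apply: eq_Rintegral => x _; rewrite -pE.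
Qed.

(** Integrating factor: [k] is the inverse of [gauss r^-1], and [f * k] has zero derivative. *)
Let gauss_ode (f f' : R -> R) : (forall t : R, is_derive t (1 : R) f (f' t)) ->
  (forall t, r ^+ 2 * f' t = - t * f t) ->
  forall t, f t = f 0 * gauss r^-1 t.
Proof.
move=> df f'E t.
have r20 : r ^+ 2 != 0 by rewrite expf_neq0// gt_eqF.
pose k : R -> R := expR \o (cst (r ^- 2 / 2) * (id ^+ 2)).
have dk (u : R) : is_derive u (1 : R) k (r ^- 2 * u * k u).
  apply: is_derive_eq; rewrite scaler0 addr0 expr1 !fctE /k /GRing.scale/=.
  by field; exact: lt0r_neq0.
have kE u : k u * gauss r^-1 u = 1.
  rewrite /k /gauss /= -expRD fctE -[RHS]expR0; congr expR.
  by rewrite exprMn exprVn mulrAC subrr.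
have dh (u : R) : is_derive u (1 : R) (f * k) 0.
  apply: (is_derive_eq (is_deriveM (df u) (dk u))).
  rewrite /GRing.scale/=; apply: (mulfI r20); rewrite mulr0.
  have -> : r ^+ 2 * (f u * (r ^- 2 * u * k u) + k u * f' u) =
     u * f u * k u + k u * (r ^+ 2 * f' u) by field; exact: lt0r_neq0.
  by rewrite f'E; ring.
have hE := is_derive_0_is_cst t 0 dh.
rewrite -[f t]mulr1 -(kE t) mulrA -[f t * k t]/((f * k) t) hE.
by rewrite fctE /k /= !fctE/= expr0n mulr0 expR0 mulr1.
Qed.

(** By [gcos1], [gsin 0] solves the Gaussian differential equation with initial value 0; this takes
    the place of an oddness argument. *)
Lemma gsin0 t : gsin 0 t = 0.
Proof.
have d (u : R) : is_derive u (1 : R) (gsin 0) (gcos 1 u).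
  apply: (@gderive (fun u x => x ^+ 0 * sin (u * x) * gauss r x)
    (fun u x => x ^+ 1 * cos (u * x) * gauss r x)) => [v|v x|v x].
  - exact: integrable_gsin.
  - have -> : (fun y : R => x ^+ 0 * sin (y * x) * gauss r x) =
      cst (gauss r x) * (fun y => sin (x * y)).
      by apply/funext => y; rewrite fctE mul1r mulrC (mulrC x).
    apply: (is_derive_eq (is_deriveM (is_derive_cst _ _ _) (is_derive_sinM x v))).
    by rewrite scaler0 addr0 /GRing.scale/= (mulrC x v); ring.
  - rewrite expr1 !normrM (ger0_norm (gauss_ge0 _ _)) ler_wpM2r ?gauss_ge0//.
    by rewrite ler_piMr//; exact: (trig_le1 _).1.
rewrite (gauss_ode d gcos1) {1}/gsin.
by under eq_Rintegral do rewrite mul0r sin0 mulr0 mul0r; rewrite Rintegral_cst// !mul0r.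
Qed.

(** The recurrence [gsin1] is the differential equation, and the constant is the value at [t = 0],
    the total mass of [gauss r]. *)
Lemma gcos0 t : gcos 0 t = Num.sqrt (2 * pi) / r * gauss r^-1 t.
Proof.
have d (u : R) : is_derive u (1 : R) (gcos 0) (- gsin 1 u).
  rewrite /gsin (_ : - _ = \int[lambda]_x (- x * sin (u * x) * gauss r x)); last first.
    rewrite -mulN1r -RintegralZl//; last exact: integrable_gsin.
    by apply: eq_Rintegral => x _; ring.
  apply: (@gderive (fun u x => x ^+ 0 * cos (u * x) * gauss r x)
    (fun u x => - x * sin (u * x) * gauss r x)) => [v|v x|v x].
  - exact: integrable_gcos.
  - have -> : (fun y : R => x ^+ 0 * cos (y * x) * gauss r x) =
      cst (gauss r x) * (fun y => cos (x * y)).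
      by apply/funext => y; rewrite fctE mul1r mulrC (mulrC x).
    apply: (is_derive_eq (is_deriveM (is_derive_cst _ _ _) (is_derive_cosM x v))).
    by rewrite scaler0 addr0 /GRing.scale/= (mulrC x v); ring.
  - rewrite !normrM normrN (ger0_norm (gauss_ge0 _ _)) ler_wpM2r ?gauss_ge0//.
    by rewrite ler_piMr//; exact: (trig_le1 _).2.
rewrite (gauss_ode d); last by move=> u; rewrite mulrN gsin1 mulNr.
congr (_ * _); rewrite -(integrable_gauss r0).2.
by apply: eq_Rintegral => x _; rewrite mul0r cos0 expr0 !mul1r.
Qed.

End moments.

Section complex_moments.
Variables (r : R) (r0 : 0 < r).

Lemma cint_gauss t :
  cintble lambda (fun x => expi (t * x) * (gauss r x)%:C) /\
  cint lambda (fun x => expi (t * x) * (gauss r x)%:C) =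
  (Num.sqrt (2 * pi) / r * gauss r^-1 t)%:C.
Proof.
have rE x : Re (expi (t * x) * (gauss r x)%:C) = x ^+ 0 * cos (t * x) * gauss r x.
  by rewrite RecM /= mulr0 subr0 mul1r.
have iE x : Im (expi (t * x) * (gauss r x)%:C) = x ^+ 0 * sin (t * x) * gauss r x.
  by rewrite ImcM /= mulr0 add0r mul1r.
split; first split.
- by under eq_fun do rewrite rE; exact: integrable_gcos.
- by under eq_fun do rewrite iE; exact: integrable_gsin.
apply: eq_complexP; rewrite ?Re_cint ?Im_cint.
- by under eq_Rintegral do rewrite rE; rewrite -(gcos0 r0).
- by under eq_Rintegral do rewrite iE; exact: gsin0.
Qed.

(* [P := (- i c - r^2 x)^2 - r^2] is the factor in
   [(expi (- c x) * gauss r x)'' = P * expi (- c x) * gauss r x]. *)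
Lemma cint_gauss_deriv2 (c e : R) :
  let P (x : R) := (((r ^+ 2 * x) ^+ 2 - c ^+ 2 - r ^+ 2) +i* (2 * c * r ^+ 2 * x)) in
  cintble lambda (fun x => P x * (expi ((e - c) * x) * (gauss r x)%:C)) /\
  cint lambda (fun x => P x * (expi ((e - c) * x) * (gauss r x)%:C)) =
  (- e ^+ 2)%:C * cint lambda (fun x => expi ((e - c) * x) * (gauss r x)%:C).
Proof.
set t := e - c => P.
have rE x : Re (P x * (expi (t * x) * (gauss r x)%:C)) =
   1 * (r ^+ 4 * (x ^+ 2 * cos (t * x) * gauss r x) +
   (- c ^+ 2 - r ^+ 2) * (x ^+ 0 * cos (t * x) * gauss r x)) +
   (- (2 * c * r ^+ 2)) * (x ^+ 1 * sin (t * x) * gauss r x).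
  by rewrite ?(RecM, ImcM) /=; ring.
have iE x : Im (P x * (expi (t * x) * (gauss r x)%:C)) =
   1 * (r ^+ 4 * (x ^+ 2 * sin (t * x) * gauss r x) +
   (- c ^+ 2 - r ^+ 2) * (x ^+ 0 * sin (t * x) * gauss r x)) +
   (2 * c * r ^+ 2) * (x ^+ 1 * cos (t * x) * gauss r x).
  by rewrite ?(RecM, ImcM) /=; ring.
have [i1 e1] := RintegralL3 (r ^+ 4) (- c ^+ 2 - r ^+ 2) (- (2 * c * r ^+ 2))
  (integrable_gcos r0 t (isT : 2 <= 2)%N) (integrable_gcos r0 t (isT : 0 <= 2)%N)
  (integrable_gsin r0 t (isT : 1 <= 2)%N).
have [i2 e2] := RintegralL3 (r ^+ 4) (- c ^+ 2 - r ^+ 2) (2 * c * r ^+ 2)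
  (integrable_gsin r0 t (isT : 2 <= 2)%N) (integrable_gsin r0 t (isT : 0 <= 2)%N)
  (integrable_gcos r0 t (isT : 1 <= 2)%N).
have r20 : r ^+ 2 != 0 by rewrite expf_neq0// gt_eqF.
split; first split.
- by under eq_fun do rewrite rE.
- by under eq_fun do rewrite iE.
have [_ ->] := cint_gauss t; rewrite -(gcos0 r0).
have s1 := gsin1 r0 t; have s2 := gsin2 r0 t; have c1 := gcos1 r0 t.
have c2 := gcos2 r0 t; rewrite (gsin0 r0) in s2 c1.
(* The integrands of [gcos 1] and [gsin 2] are odd; that the integrals vanish is read off from the
   recurrences, and kills the imaginary part. The real part adds up to [- (t + c)^2] times
   [gcos 0]. *)
have c10 : gcos r 1 t = 0 by apply: (mulfI r20); rewrite c1 !mulr0.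
have s20 : gsin r 2 t = 0 by apply: (mulfI r20); rewrite s2 c10 !mulr0 addr0.
have eE : e = t + c by rewrite /t subrK.
apply: eq_complexP; rewrite ?(RecM, ImcM) ?Re_cint ?Im_cint [RHS]/= ?mul0r.
- under eq_Rintegral do rewrite rE.
  rewrite e1 -!/(gcos _ _ _) -!/(gsin _ _ _) subr0 eE.
  have -> : r ^+ 4 * gcos r 2 t = r ^+ 2 * (gcos r 0 t) - t * (r ^+ 2 * gsin r 1 t).
    have -> : r ^+ 4 * gcos r 2 t = r ^+ 2 * (r ^+ 2 * gcos r 2 t) by ring.
    by rewrite c2; ring.
  have -> : - (2 * c * r ^+ 2) * gsin r 1 t = - (2 * c) * (r ^+ 2 * gsin r 1 t) by ring.
  rewrite s1; ring.
- under eq_Rintegral do rewrite iE.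
  rewrite e2 -!/(gcos _ _ _) -!/(gsin _ _ _) c10 s20 (gsin0 r0); ring.
Qed.

End complex_moments.
End gauss1.

(** * Modulated Gaussians as Schwartz functions *)

Section dot_product.
Context {R : realType} {n : nat}.
Implicit Types x y z : 'rV[R]_n.

Lemma dotC x y : dot x y = dot y x.
Proof. by apply: eq_bigr => i _; rewrite mulrC. Qed.

Lemma dotDl x y z : dot (x + y) z = dot x z + dot y z.
Proof.
by rewrite /dot -big_split/=; apply: eq_bigr => i _; rewrite mxE mulrDl.
Qed.

Lemma dotNl x z : dot (- x) z = - dot x z.
Proof. by rewrite /dot -sumrN; apply: eq_bigr => i _; rewrite mxE mulNr. Qed.

Lemma dotZl (a : R) x z : dot (a *: x) z = a * dot x z.
Proof. by rewrite /dot mulr_sumr; apply: eq_bigr => i _; rewrite mxE mulrA. Qed.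

Lemma dotDr x y z : dot z (x + y) = dot z x + dot z y.
Proof. by rewrite dotC dotDl !(dotC z). Qed.

Lemma dotNr x z : dot z (- x) = - dot z x.
Proof. by rewrite dotC dotNl (dotC z). Qed.

Lemma dot_ge0 x : 0 <= dot x x.
Proof. by apply: sumr_ge0 => i _; rewrite -expr2 sqr_ge0. Qed.

Lemma sqr_coord_le_dot x (i : 'I_n) : x ord0 i ^+ 2 <= dot x x.
Proof.
rewrite /dot (bigD1 i)//= expr2 lerDl.
by apply: sumr_ge0 => j _; rewrite -expr2 sqr_ge0.
Qed.

Lemma jbracket_sqr x : jbracket x ^+ 2 = 1 + dot x x.
Proof. by rewrite sqr_sqrtr// addr_ge0// dot_ge0. Qed.

Lemma jbracket_ge1 x : 1 <= jbracket x.
Proof.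
by rewrite -[leLHS]sqrtr1; apply: ler_wsqrtr; rewrite lerDl dot_ge0.
Qed.

Lemma jbracket_gt0 x : 0 < jbracket x.
Proof. exact: lt_le_trans (jbracket_ge1 x). Qed.

Lemma coord_le_jbracket x (i : 'I_n) : `|x ord0 i| <= jbracket x.
Proof.
rewrite -sqrtr_sqr; apply: ler_wsqrtr.
by rewrite (le_trans (sqr_coord_le_dot x i))// lerDr.
Qed.

(* [ |x + y|^2 <= 2 |x|^2 + 2 |y|^2 ] *)
Lemma jbracketD_le x y : jbracket (x + y) <= 2 * (jbracket x * jbracket y).
Proof.
rewrite -(@ler_pXn2r _ 2)// ?nnegrE ?mulr_ge0 ?(ltW (jbracket_gt0 _))//.
rewrite !exprMn !jbracket_sqr.
have := dot_ge0 (x - y); rewrite !(dotDl, dotDr, dotNl, dotNr) (dotC y x).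
have := dot_ge0 x; have := dot_ge0 y; nra.
Qed.

End dot_product.

Section gaussian_schwartz.
Context {R : realType} {n : nat}.
Local Notation Rn := 'rV[R]_n.
Implicit Types f g : Rn -> R.

(** Differentiability bundled with explicit partial derivatives, so that closure rules compute
    gradients. *)
Definition hasgrad f (df : 'I_n -> Rn -> R) : Prop :=
  forall x, differentiable f x /\
    forall i, 'D_(delta_mx ord0 i) f x = df i x.

Lemma hasgrad_cst (a : R) : hasgrad (cst a) (fun _ _ => 0).
Proof. by move=> x; split => [|i]; rewrite ?derive_cst. Qed.

Lemma hasgrad_coord (j : 'I_n) :
  hasgrad (fun x => x ord0 j) (fun i _ => (i == j)%:R).
Proof.
move=> x; have dc := @differentiable_coord R 1 n x ord0 j; split => // i.
rewrite /derive; apply/cvg_lim => //; apply: cvg_near_cst.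
near=> h; rewrite /= !mxE eqxx/= addrK.
have h0 : h != 0 by near: h; exact: nbhs_dnbhs_neq.
by rewrite /GRing.scale/= mulrA mulVf// mul1r eq_sym.
Unshelve. all: by end_near. Qed.

Lemma hasgradD f g df dg : hasgrad f df -> hasgrad g dg ->
  hasgrad (fun x => f x + g x) (fun i x => df i x + dg i x).
Proof.
move=> fP gP x; have [fx fi] := fP x; have [gx gi] := gP x; split=> [|i].
  exact: differentiableD.
by rewrite deriveD ?fi ?gi//; exact: diff_derivable.
Qed.

Lemma hasgradM f g df dg : hasgrad f df -> hasgrad g dg ->
  hasgrad (fun x => f x * g x) (fun i x => f x * dg i x + g x * df i x).
Proof.
move=> fP gP x; have [fx fi] := fP x; have [gx gi] := gP x; split=> [|i].
  exact: differentiableM.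
by rewrite deriveM ?fi ?gi//; exact: diff_derivable.
Qed.

Lemma hasgrad_comp (h h' : R -> R) f df :
  (forall y : R, is_derive y (1 : R) h (h' y)) -> hasgrad f df ->
  hasgrad (fun x => h (f x)) (fun i x => h' (f x) * df i x).
Proof.
move=> dh fP x; have [fx fi] := fP x.
have hy : differentiable h (f x) by apply/derivable1_diffP; have [] := dh (f x).
split=> [|i]; first exact: differentiable_comp.
rewrite deriveE; last exact: differentiable_comp.
rewrite (diff_comp fx hy)/= diff1E// -deriveE// fi derive1E.
by rewrite /GRing.scale/= mulrC; have [_ ->] := dh (f x).
Qed.

Lemma hasgrad_sum (I : Type) (s : seq I) (F : I -> Rn -> R) dF :
  (forall i, hasgrad (F i) (dF i)) ->
  hasgrad (fun x => \sum_(i <- s) F i x) (fun j x => \sum_(i <- s) dF i j x).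
Proof.
move=> FP; elim: s => [|i s ih] x.
  under eq_fun do rewrite big_nil; have [d g] := hasgrad_cst 0 x.
  by split => // j; rewrite g big_nil.
under eq_fun do rewrite big_cons; have [d g] := hasgradD (FP i) ih x.
by split => // j; rewrite g big_cons.
Qed.

Lemma hasgrad_dotr (c : Rn) :
  hasgrad (fun x => dot x c) (fun i _ => c ord0 i).
Proof.
have := hasgrad_sum (index_enum 'I_n)
  (fun i => hasgradM (hasgrad_coord i) (hasgrad_cst (c ord0 i))).
move=> H x; have [? H'] := H x; split => // i.
rewrite H' (bigD1 i)//= eqxx mulr0 add0r mulr1 big1 ?addr0// => j ji.
by rewrite eq_sym (negbTE ji) !mulr0 addr0.
Qed.

Lemma hasgrad_dot : hasgrad (fun x => dot x x) (fun i x => 2 * x ord0 i).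
Proof.
have := hasgrad_sum (index_enum 'I_n)
  (fun i => hasgradM (hasgrad_coord i) (hasgrad_coord i)).
move=> H x; have [? H'] := H x; split => // i.
rewrite H' (bigD1 i)//= eqxx big1 ?addr0; last first.
  by move=> j ji; rewrite eq_sym (negbTE ji) !mulr0 addr0.
by rewrite mulr1; ring.
Qed.

Variables (r : R) (c : Rn).

(** Syntax for polynomials in the coordinates, [cos (x.c)] and [sin (x.c)]. Being Schwartz concerns
    all iterated derivatives; a derivative of such an expression times the Gaussian is again of this
    form, so one induction on the list of directions covers them all. *)
Inductive texpr :=
| TCst of R | TCoord of 'I_n | TCos | TSin
| TAdd of texpr & texpr | TMul of texpr & texpr.

Fixpoint teval e (x : Rn) : R :=
  match e with
  | TCst a => a | TCoord i => x ord0 i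
  | TCos => cos (dot x c) | TSin => sin (dot x c)
  | TAdd a b => teval a x + teval b x
  | TMul a b => teval a x * teval b x
  end.

Fixpoint tderiv i e :=
  match e with
  | TCst a => TCst 0 | TCoord j => TCst (i == j)%:R
  | TCos => TMul (TCst (- c ord0 i)) TSin
  | TSin => TMul (TCst (c ord0 i)) TCos
  | TAdd a b => TAdd (tderiv i a) (tderiv i b)
  | TMul a b => TAdd (TMul a (tderiv i b)) (TMul b (tderiv i a))
  end.

Definition gaussn (x : Rn) : R := expR (- (r ^+ 2 / 2 * dot x x)).

(** Leibniz rule with the Gaussian factored out: its logarithmic derivative in direction [i] is
    [- r^2 x_i]. *)
Definition tgderiv i e :=
  TAdd (tderiv i e) (TMul (TMul (TCst (- r ^+ 2)) (TCoord i)) e).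

Lemma hasgrad_teval e : hasgrad (teval e) (fun i => teval (tderiv i e)).
Proof.
elim: e => [a|j| | |a iha b ihb|a iha b ihb] /=.
- exact: hasgrad_cst.
- exact: hasgrad_coord.
- have H := hasgrad_comp (@is_derive_cos R) (hasgrad_dotr c).
  by move=> x; have [? H'] := H x; split => // i; rewrite H'; ring.
- have H := hasgrad_comp (@is_derive_sin R) (hasgrad_dotr c).
  by move=> x; have [? H'] := H x; split => // i; rewrite H' mulrC.
- exact: hasgradD.
- exact: hasgradM.
Qed.

Lemma hasgrad_gaussn :
  hasgrad gaussn (fun i x => - r ^+ 2 * x ord0 i * gaussn x).
Proof.
have H := hasgrad_comp (@is_derive_expR R)
  (hasgradM (hasgrad_cst (- (r ^+ 2 / 2))) hasgrad_dot).
rewrite /gaussn; under eq_fun do rewrite -mulNr.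
move=> x; have [? H'] := H x; split => // i; rewrite H' /cst !mulNr.
by field.
Qed.

Lemma hasgrad_teval_gaussn e :
  hasgrad (fun x => teval e x * gaussn x)
    (fun i x => teval (tgderiv i e) x * gaussn x).
Proof.
have H := hasgradM (hasgrad_teval e) hasgrad_gaussn.
move=> x; have [? H'] := H x; split => // i; rewrite H' /=; ring.
Qed.

Lemma pderivs_teval s e :
  pderivs s (fun x => teval e x * gaussn x) =
  (fun x => teval (foldr tgderiv e s) x * gaussn x).
Proof.
elim: s => [//|i s ih]; rewrite /pderivs/= -/(pderivs s _) ih.
apply/funext => x; rewrite /pderiv.
by have [_ ->] := hasgrad_teval_gaussn (foldr tgderiv e s) x.
Qed.

Lemma teval_bound e : exists K m, 0 <= K /\
  forall x, `|teval e x| <= K * jbracket x ^+ m.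
Proof.
have w1 m (x : Rn) : 1 <= jbracket x ^+ m by rewrite exprn_ege1// jbracket_ge1.
elim: e => [a|j| | |a [K [m [K0 Km]]] b [L [p [L0 Lp]]]|
  a [K [m [K0 Km]]] b [L [p [L0 Lp]]]] /=.
- by exists `|a|, 0%N; split => // x; rewrite expr0 mulr1.
- by exists 1, 1%N; split => // x; rewrite mul1r; exact: coord_le_jbracket.
- exists 1, 0%N; split => // x.
  by rewrite expr0 mulr1 ler_norml cos_le1 cos_geN1.
- exists 1, 0%N; split => // x.
  by rewrite expr0 mulr1 ler_norml sin_le1 sin_geN1.
- exists (K + L), (m + p)%N; split => [|x]; first exact: addr_ge0.
  rewrite (le_trans (ler_normD _ _))// mulrDl lerD//.
    rewrite (le_trans (Km x))// ler_wpM2l// exprD ler_peMr//.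
    by rewrite (le_trans _ (w1 m x)).
  rewrite (le_trans (Lp x))// ler_wpM2l// exprD ler_peMl//.
  by rewrite (le_trans _ (w1 p x)).
- exists (K * L), (m + p)%N; split => [|x]; first exact: mulr_ge0.
  by rewrite normrM exprD mulrACA ler_pM.
Qed.

Hypothesis r0 : 0 < r.

Lemma rschwartz_teval e : rschwartz (fun x => teval e x * gaussn x).
Proof.
move=> s; rewrite pderivs_teval; split=> [x|N].
  by have [] := hasgrad_teval_gaussn (foldr tgderiv e s) x.
have [K [m [K0 Km]]] := teval_bound (foldr tgderiv e s).
pose M := (N + m)%N.
(* With [t = r^2 <x>^2 / 2] the Gaussian equals [exp (r^2 / 2) / exp t]. Then [<x>^M] is at most
   [(<x>^2)^(M+1)], that is [(2 / r^2)^(M+1) t^(M+1)], and [t^(M+1) / (M+1)!] is at most [exp t].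
   Doubling the exponent avoids roots of [t]. *)
exists (K * ((2 / r ^+ 2) ^+ M.+1 * M.+1`!%:R * expR (r ^+ 2 / 2))) => x.
have w0 := jbracket_gt0 x; have w1 := jbracket_ge1 x.
rewrite normrM (ger0_norm (expR_ge0 _)) -/(gaussn x).
rewrite (@le_trans _ _ (K * (jbracket x ^+ M * gaussn x)))//.
  rewrite exprD -!mulrA (mulrCA K) ler_wpM2l ?exprn_ge0 ?(ltW w0)//.
  by rewrite mulrA ler_wpM2r ?expR_ge0.
rewrite ler_wpM2l//.
pose t := r ^+ 2 / 2 * jbracket x ^+ 2.
have t0 : 0 <= t by rewrite mulr_ge0 ?divr_ge0 ?sqr_ge0.
have gE : gaussn x = expR (r ^+ 2 / 2) / expR t.
  rewrite -expRN -expRD /gaussn; congr expR.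
  by rewrite /t jbracket_sqr; ring.
rewrite gE mulrA ler_pdivrMr ?expR_gt0// mulrAC [leRHS]mulrAC.
rewrite ler_wpM2r ?expR_ge0//.
have wt : jbracket x ^+ 2 = 2 / r ^+ 2 * t.
  by rewrite /t; field; exact: lt0r_neq0.
rewrite (@le_trans _ _ ((jbracket x ^+ 2) ^+ M.+1))//.
  by rewrite -exprM ler_weXn2l// mul2n -addnn (leq_trans (leqnSn M))// leq_addr.
rewrite wt exprMn -mulrA ler_wpM2l ?exprn_ge0 ?divr_ge0 ?sqr_ge0//.
rewrite mulrC -ler_pdivrMr ?ltr0n ?fact_gt0//.
by rewrite (le_trans _ (expR_ge1Dxn M t0))// lerDr.
Qed.

Definition mgauss (x : Rn) : R[i] := expi (- dot x c) * (gaussn x)%:C.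

Lemma Re_mgauss x : Re (mgauss x) = teval TCos x * gaussn x.
Proof. by rewrite /mgauss RecM /= cosN mulr0 subr0. Qed.

Lemma Im_mgauss x : Im (mgauss x) = teval (TMul (TCst (-1)) TSin) x * gaussn x.
Proof. by rewrite /mgauss ImcM /= sinN mulr0 add0r mulN1r. Qed.

Lemma schwartz_mgauss : schwartz mgauss.
Proof.
split.
- by under eq_fun do rewrite Re_mgauss; exact: rschwartz_teval.
- by under eq_fun do rewrite Im_mgauss; exact: rschwartz_teval.
Qed.

(** The factor [P] of [cint_gauss_deriv2], for one coordinate. *)
Definition gauss_deriv2 (b y : R) : R[i] :=
  ((r ^+ 2 * y) ^+ 2 - b ^+ 2 - r ^+ 2) +i* (2 * b * r ^+ 2 * y).

Lemma laplacian_mgauss x :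
  laplacian mgauss x =
  \sum_(i < n) gauss_deriv2 (c ord0 i) (x ord0 i) * mgauss x.
Proof.
have Re_sum (F : 'I_n -> R[i]) : Re (\sum_i F i) = \sum_i Re (F i).
  by rewrite (big_morph (@complex.Re R) (@RecD R) erefl).
have Im_sum (F : 'I_n -> R[i]) : Im (\sum_i F i) = \sum_i Im (F i).
  by rewrite (big_morph (@complex.Im R) (@ImcD R) erefl).
rewrite /laplacian; under [X in X +i* _]eq_bigr => i _.
  rewrite (_ : (fun y => Re (mgauss y)) = fun y => teval TCos y * gaussn y); last first.
    by apply/funext => y; exact: Re_mgauss.
  rewrite pderivs_teval/=; over.
under [X in _ +i* X]eq_bigr => i _.
  rewrite (_ : (fun y => Im (mgauss y)) =
    fun y => teval (TMul (TCst (-1)) TSin) y * gaussn y); last first.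
    by apply/funext => y; exact: Im_mgauss.
  rewrite pderivs_teval/=; over.
apply: eq_complexP; rewrite ?Re_sum ?Im_sum /=; apply: eq_bigr => i _.
- by rewrite eqxx mulr1n cosN sinN; ring.
- by rewrite eqxx mulr1n cosN sinN; ring.
Qed.

Lemma mgauss_prod x :
  mgauss x = \prod_(i < n) (expi (- c ord0 i * x ord0 i) * (gauss r (x ord0 i))%:C).
Proof.
rewrite big_split/= /mgauss; congr (_ * _).
- rewrite /dot -sumrN (big_morph _ (@expiD R) (@expi0 R)).
  by apply: eq_bigr => i _; congr expi; ring.
- rewrite /gaussn /dot mulr_sumr -sumrN.
  rewrite (big_morph _ (@expRD R) (@expR0 R)).
  rewrite real_complex_prod.
  apply: eq_bigr => i _; congr (_%:C); congr expR; ring.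
Qed.

Lemma gaussn_prod x : (gaussn x)%:C = \prod_(i < n) (gauss r (x ord0 i))%:C.
Proof.
rewrite /gaussn /dot mulr_sumr -sumrN.
rewrite (big_morph _ (@expRD R) (@expR0 R)).
rewrite real_complex_prod.
by apply: eq_bigr => i _; congr (_%:C); congr expR; ring.
Qed.

End gaussian_schwartz.

(** * Fourier integrals of modulated Gaussians and of their Laplacians *)

Section gaussian_fourier.
Context {R : realType} {n : nat}.
Local Notation tupleR n := (n.-tuple (measurableTypeR R)).
Local Notation mu := (lebesgueRn R n).
Variables (r : R) (c : 'rV[R]_n).
Hypothesis r0 : 0 < r.

Let expi_mgauss (xi : 'rV[R]_n) (t : tupleR n) :
  expi (dot (rowv t) xi) * mgauss r c (rowv t) =
  \prod_(i < n) (expi ((xi ord0 i - c ord0 i) * tnth t i) * (gauss r (tnth t i))%:C).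
Proof.
rewrite mgauss_prod /dot (big_morph _ (@expiD R) (@expi0 R)) -big_split/=.
by apply: eq_bigr => i _; rewrite mulrA -expiD mxE; congr (expi _ * _); ring.
Qed.

Lemma cint_mgauss (xi : 'rV[R]_n) :
  cintble mu (fun t => expi (dot (rowv t) xi) * mgauss r c (rowv t)) /\
  cint mu (fun t => expi (dot (rowv t) xi) * mgauss r c (rowv t)) =
  ((Num.sqrt (2 * pi) / r) ^+ n * gaussn r^-1 (xi - c))%:C.
Proof.
have := cint_tensor (fun i => (cint_gauss r0 (xi ord0 i - c ord0 i)).1).
under eq_fun do rewrite -expi_mgauss.
move=> [? ->]; split => //.
rewrite real_complexM real_complexX gaussn_prod.
have -> : ((Num.sqrt (2 * pi) / r)%:C ^+ n =
    \prod_(i < n) (Num.sqrt (2 * pi) / r)%:C)%R by rewrite prodr_const card_ord.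
rewrite -big_split/=; apply: eq_bigr => i _.
by rewrite (cint_gauss r0 _).2 real_complexM !mxE.
Qed.

(** The Laplacian is a sum of tensor products, the j-th of which differs from the plain Gaussian in
    its j-th factor only; [cint_tensor] then applies termwise. *)
Let expi_laplacian (xi : 'rV[R]_n) (t : tupleR n) :
  expi (dot (rowv t) xi) * laplacian (mgauss r c) (rowv t) =
  \sum_(j < n) \prod_(i < n) (if i == j then
     gauss_deriv2 r (c ord0 i) (tnth t i) *
      (expi ((xi ord0 i - c ord0 i) * tnth t i) * (gauss r (tnth t i))%:C)
   else expi ((xi ord0 i - c ord0 i) * tnth t i) * (gauss r (tnth t i))%:C).
Proof.
rewrite laplacian_mgauss// mulr_sumr; apply: eq_bigr => j _.
rewrite mulrCA expi_mgauss (bigD1 j)//= [RHS](bigD1 j)//= eqxx mxE.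
rewrite -!mulrA; congr (_ * (_ * (_ * _))).
by apply: eq_bigr => i ij; rewrite (negbTE ij).
Qed.

Lemma cint_laplacian_mgauss (xi : 'rV[R]_n) :
  cintble mu (fun t => expi (dot (rowv t) xi) * laplacian (mgauss r c) (rowv t)) /\
  cint mu (fun t => expi (dot (rowv t) xi) * laplacian (mgauss r c) (rowv t)) =
  (- dot xi xi)%:C *
  cint mu (fun t => expi (dot (rowv t) xi) * mgauss r c (rowv t)).
Proof.
pose F (j i : 'I_n) (x : measurableTypeR R) :=
  if i == j then gauss_deriv2 r (c ord0 i) x *
      (expi ((xi ord0 i - c ord0 i) * x) * (gauss r x)%:C)
  else expi ((xi ord0 i - c ord0 i) * x) * (gauss r x)%:C.
have Fi j i : cintble lebesgue_measure (F j i).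
  rewrite /F; case: eqP => _; last exact: (cint_gauss r0 _).1.
  exact: (cint_gauss_deriv2 r0 _ _).1.
have T j := cint_tensor (Fi j).
have E (t : tupleR n) : expi (dot (rowv t) xi) * laplacian (mgauss r c) (rowv t) =
    \sum_(j < n) \prod_(i < n) F j i (tnth t i) by exact: expi_laplacian.
under eq_fun do rewrite E; split; first by apply: cintble_sum => j; exact: (T j).1.
rewrite cint_sum => [|j]; last exact: (T j).1.
rewrite (_ : (fun t : tupleR n => expi (dot (rowv t) xi) * mgauss r c (rowv t)) =
  fun t => \prod_(i < n) (expi ((xi ord0 i - c ord0 i) * tnth t i) * (gauss r (tnth t i))%:C));
  last by apply/funext => t; exact: expi_mgauss.
have := cint_tensor (fun i => (cint_gauss r0 (xi ord0 i - c ord0 i)).1).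
move=> [_ ->]; rewrite /dot -sumrN real_complex_sum mulr_suml; apply: eq_bigr => j _.
rewrite (T j).2 (bigD1 j)//= [in RHS](bigD1 j)//= mulrA; congr (_ * _).
  by rewrite /F eqxx (cint_gauss_deriv2 r0 _ _).2 expr2.
by apply: eq_bigr => i ij; rewrite /F (negbTE ij).
Qed.

End gaussian_fourier.

(** * Gaussian approximate identity *)

Section continuous_measurable_Rn.
Context {R : realType} {n : nat}.
Local Notation tupleR n := (n.-tuple (measurableTypeR R)).
Local Notation mu := (lebesgueRn R n).

(** Bridge from the topology of row vectors to the product sigma-algebra of tuples: an open set is
    the union of the countably many rational cubes that it contains. *)
Lemma measurable_open_rowv (U : set 'rV[R]_n) : open U ->
  measurable ((@rowv R n) @^-1` U).
Proof.
move=> oU.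
pose box (qk : n.-tuple rat * nat) : set (tupleR n) :=
  \bigcap_(i in [set: 'I_n]) [set t | `|tnth t i - ratr (tnth qk.1 i)| < qk.2.+1%:R^-1].
have mbox qk : measurable (box qk).
  apply: fin_bigcap_measurable; first exact: finite_finset.
  move=> i _; rewrite -[X in measurable X]setTI.
  have mf : measurable_fun setT
      (fun t : tupleR n => `|tnth t i - ratr (tnth qk.1 i)|).
    apply: measurableT_comp => //; apply: measurable_funB => //.
    exact: measurable_tnth.
  have := mf measurableT `]-oo, qk.2.+1%:R^-1[%classic (measurable_itv _).
  by congr (measurable (_ `&` _)); apply/seteqP; split => t /=; rewrite in_itv.
(* Cubes not contained in [U] are replaced by [set0], so that the union runs over a whole countable
   type. *)
rewrite (_ : _ @^-1` _ = \bigcup_(qk : n.-tuple rat * nat)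
    (if `[< forall t, box qk t -> U (rowv t) >] then box qk else set0)); last first.
  apply/seteqP; split => [t Ut|t [qk _]]; last first.
    by case: ifPn => // /asboolP; exact.
  have : nbhs (rowv t) U by exact: open_nbhs_nbhs.
  move=> /nbhs_ballP[e /= e0 eU].
  have [k _ ke] := near_infty_natSinv_lt (PosNum (divr_gt0 e0 (ltr0n R 2))).
  have k2 : (k.+1%:R^-1 : R) < e / 2 by exact: (ke k (leqnn k)).
  have k0 : 0 < (k.+1%:R^-1 : R) by rewrite invr_gt0.
  have qP (i : 'I_n) : exists q : rat, `|tnth t i - ratr q| < k.+1%:R^-1.
    have /rat_in_itvoo[q] : tnth t i - k.+1%:R^-1 < tnth t i + k.+1%:R^-1.
      by rewrite ltrBlDr -addrA ltrDl addr_gt0.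
    rewrite in_itv/= => /andP[q1 q2]; exists q.
    by rewrite ltr_distlC q1 q2.
  pose q := [tuple (projT1 (cid (qP i))) | i < n].
  have qE i : `|tnth t i - ratr (tnth q i)| < k.+1%:R^-1.
    by rewrite tnth_mktuple; case: cid.
  exists (q, k) => //; case: ifPn => [_ i _|/asboolP]; first exact: qE.
  case=> s sbox; apply: eU; split => //.
  move=> i j; rewrite !mxE /ball/=.
  have := sbox j I; rewrite /= => sj; have tj := qE j.
  rewrite (le_lt_trans (ler_distD (ratr (tnth q j)) _ _))//.
  rewrite (splitr e) ltrD ?(lt_trans tj k2)//.
  by rewrite distrC (lt_trans sj k2).
apply: countable_bigcupT_measurable => // qk.
by case: ifP => _; [exact: mbox|exact: measurable0].
Qed.

Lemma measurable_continuous_rowv (f : 'rV[R]_n -> R) : continuous f ->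
  measurable_fun setT (fun t : tupleR n => f (rowv t)).
Proof.
move=> cf; apply: (measurability _ (RGenOInfty.measurableE R)) => //.
move=> _ [_ [x ->] <-]; rewrite setTI.
apply: (@measurable_open_rowv (f @^-1` `]x, +oo[%classic)).
by apply: open_comp => //; exact: interval_open.
Qed.

Lemma hasgrad_continuous (f : 'rV[R]_n -> R) df : hasgrad f df -> continuous f.
Proof. by move=> H x; apply: differentiable_continuous; have [] := H x. Qed.

Lemma measurable_dotr (c : 'rV[R]_n) :
  measurable_fun setT (fun t : tupleR n => dot (rowv t) c).
Proof.
apply: (@measurable_continuous_rowv (fun x => dot x c)).
exact: hasgrad_continuous (hasgrad_dotr c).
Qed.

Lemma continuous_affine (a : R) (v : 'rV[R]_n) : continuous (fun x : 'rV[R]_n => a *: x + v).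
Proof.
move=> x; apply: (@continuousD _ _ _ (fun x : 'rV_n => a *: x) (cst v)).
  exact: scaler_continuous.
exact: cst_continuous.
Qed.

Lemma continuous_comp_affine (h : 'rV[R]_n -> R) (a : R) (v : 'rV[R]_n) :
  continuous h -> continuous (fun x : 'rV[R]_n => h (a *: x + v)).
Proof.
by move=> ch x; exact: (cvg_comp _ _ (@continuous_affine a v x) (ch _)).
Qed.

Lemma measurable_gaussn (r : R) (c : 'rV[R]_n) :
  measurable_fun setT (fun t : tupleR n => gaussn r (rowv t - c)).
Proof.
under eq_fun do rewrite -[rowv _]scale1r.
apply: (@measurable_continuous_rowv (fun x => gaussn r (1 *: x - c))).
apply: continuous_comp_affine.
exact: hasgrad_continuous (hasgrad_gaussn r).
Qed.

Lemma continuous_jbracket : continuous (@jbracket R n).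
Proof.
move=> x; rewrite /jbracket.
apply: (@continuous_comp _ _ _ (fun x : 'rV_n => 1 + dot x x) Num.sqrt).
  exact: hasgrad_continuous (hasgradD (hasgrad_cst 1) (@hasgrad_dot R n)) x.
exact: sqrt_continuous.
Qed.

Lemma gaussnN (r : R) (x : 'rV[R]_n) : gaussn r (- x) = gaussn r x.
Proof. by rewrite /gaussn dotNl dotNr opprK. Qed.

Lemma gaussn_ge0 (r : R) (x : 'rV[R]_n) : 0 <= gaussn r x.
Proof. exact: expR_ge0. Qed.

Lemma gaussn_le1 (r : R) (x : 'rV[R]_n) : gaussn r x <= 1.
Proof.
rewrite -expR0 ler_expR oppr_le0 mulr_ge0 ?dot_ge0//.
by rewrite divr_ge0 ?sqr_ge0.
Qed.

Lemma gaussnZ (r a : R) (x : 'rV[R]_n) : gaussn r (a *: x) = gaussn (r * a) x.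
Proof.
rewrite /gaussn dotZl dotC dotZl; congr expR; congr (- _).
by rewrite exprMn; field.
Qed.

Lemma integrable_gaussn (r : R) : 0 < r ->
  mu.-integrable setT (fun t => (gaussn r (rowv t))%:E) /\
  \int[mu]_t gaussn r (rowv t) = (Num.sqrt (2 * pi) / r) ^+ n.
Proof.
move=> r0; have [i e] := cint_mgauss 0 r0 (0 : 'rV[R]_n).
have E : (fun t : tupleR n => expi (dot (rowv t) 0) * mgauss r 0 (rowv t)) =
    (fun t => (gaussn r (rowv t))%:C).
  apply/funext => t; rewrite /mgauss mulrA -expiD.
  by rewrite addrN expi0 mul1r.
rewrite E in i e; split; first by case: i.
move/(congr1 (@complex.Re R)) : e; rewrite cint_real /= => ->.
by rewrite subr0 -(scale0r (0 : 'rV[R]_n)) gaussnZ mulr0 /gaussn expr0n !mul0r oppr0 expR0 mulr1.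
Qed.

Lemma cvg_rowv_affine (z x0 : 'rV[R]_n) :
  k.+1%:R^-1 *: z + x0 @[k --> \oo] --> x0.
Proof.
rewrite -[X in _ --> X]add0r; apply: cvgD; last exact: cvg_cst.
rewrite -(scale0r z); apply: cvgZr_tmp; exact: cvg_harmonic.
Qed.

(* The constant is [\int gaussn 1]: the kernels [k^n gaussn k] concentrate at
   [x0]. *)
Lemma gaussn_approx_identity (h : 'rV[R]_n -> R) (M : R) (x0 : 'rV[R]_n) :
  continuous h -> (forall x, `|h x| <= M) ->
  (forall k, mu.-integrable setT
    (fun t => (h (rowv t) * gaussn k.+1%:R (rowv t - x0))%:E)) /\
  (forall k, `|k.+1%:R ^+ n *
    \int[mu]_t (h (rowv t) * gaussn k.+1%:R (rowv t - x0))| <=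
    M * Num.sqrt (2 * pi) ^+ n) /\
  k.+1%:R ^+ n * \int[mu]_t (h (rowv t) * gaussn k.+1%:R (rowv t - x0))
    @[k --> \oo] --> Num.sqrt (2 * pi) ^+ n * h x0.
Proof.
move=> ch hM.
have M0 : 0 <= M by rewrite (le_trans _ (hM 0)).
have [g1i g1E] := integrable_gaussn (@ltr01 R).
rewrite divr1 in g1E.
have mh := measurable_continuous_rowv ch.
pose F k (t : tupleR n) := h (rowv t) * gaussn k.+1%:R (rowv t - x0).
have mF k : measurable_fun setT (F k).
  by apply: measurable_funM => //; exact: measurable_gaussn.
(* The substitution [x = x0 + y / (k + 1)] freezes the Gaussian, which then dominates the whole
   sequence. *)
pose G k (t : tupleR n) := h (k.+1%:R^-1 *: rowv t + x0) * gaussn 1 (rowv t).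
have mG k : measurable_fun setT (G k).
  apply: measurable_funM; last first.
    by have := measurable_gaussn 1 0; under eq_fun do rewrite subr0.
  apply: (@measurable_continuous_rowv (fun x => h (k.+1%:R^-1 *: x + x0))).
  exact: continuous_comp_affine.
have GM k t : `|G k t| <= M * gaussn 1 (rowv t).
  by rewrite normrM (ger0_norm (gaussn_ge0 _ _)) ler_wpM2r ?gaussn_ge0.
have Mgi : mu.-integrable setT (fun t => (M * gaussn 1 (rowv t))%:E).
  by under eq_fun do rewrite EFinM; exact: integrableZl.
have Gi k : mu.-integrable setT (fun t => (G k t)%:E).
  exact: (Rintegrable_le (mG k) Mgi (GM k)).
have GF k t : G k t = F k (afft k.+1%:R^-1 x0 t).
  rewrite /G /F rowv_afft addrK gaussnZ mulfV//.
have k0 k : 0 < k.+1%:R :> R by [].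
(* [F k] is the image of [G k] under the inverse affine map. *)
have FG k t : F k t = G k (afft k.+1%:R (- (k.+1%:R *: x0)) t).
  rewrite GF; congr (F k _); apply/eq_from_tnth => i; rewrite !tnth_mktuple !mxE.
  by field.
have Fi k : mu.-integrable setT (fun t => (F k t)%:E).
  under eq_fun do rewrite FG.
  exact: (integral_afft (- (k.+1%:R *: x0)) (k0 k) (Gi k)).1.
have FGE k : k.+1%:R ^+ n * \int[mu]_t F k t = \int[mu]_t G k t.
  have [_ e] := integral_afft (- (k.+1%:R *: x0)) (k0 k) (Gi k).
  under eq_Rintegral do rewrite FG.
  by rewrite e mulrA mulfV ?mul1r// expf_neq0.
split => //; split => [k|].
  rewrite FGE (le_trans (le_normr_Rintegral measurableT (Gi k)))//.
  rewrite -g1E -RintegralZl//; apply: le_Rintegral => //.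
  by have := integrable_norm (Gi k).
under eq_fun do rewrite FGE.
rewrite mulrC -g1E -RintegralZl//.
apply: (Rdominated_convergence mG _ Mgi GM).2 => t.
apply: cvgM; last exact: cvg_cst.
exact: (cvg_comp _ h (@cvg_rowv_affine (rowv t) x0) (ch x0)).
Qed.

End continuous_measurable_Rn.

(** * Integrable functions are determined by Gaussian averages *)

Section uniqueness.
Context {R : realType} {n : nat}.
Local Notation tupleR n := (n.-tuple (measurableTypeR R)).
Local Notation mu := (lebesgueRn R n).

Definition subt (p : tupleR n * tupleR n) : tupleR n :=
  [tuple tnth p.1 i - tnth p.2 i | i < n].

Lemma rowv_subt p : rowv (subt p) = rowv p.1 - rowv p.2.
Proof. by apply/rowP => i; rewrite !mxE tnth_mktuple. Qed.

Lemma measurable_subt : measurable_fun setT subt.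
Proof.
apply/measurable_fun_tnthP => i; rewrite /comp/=.
under eq_fun do rewrite tnth_mktuple.
by apply: measurable_funB;
  (apply: (measurableT_comp (measurable_tnth i))).
Qed.

Lemma afft1E (v : 'rV[R]_n) t : rowv (afft 1 v t) = rowv t + v.
Proof. by rewrite rowv_afft scale1r. Qed.

Lemma integrable_gaussn_shift (r : R) (c : 'rV[R]_n) : 0 < r ->
  mu.-integrable setT (fun t => (gaussn r (rowv t - c))%:E) /\
  \int[mu]_t gaussn r (rowv t - c) = (Num.sqrt (2 * pi) / r) ^+ n.
Proof.
move=> r0; have [gi gE] := integrable_gaussn r0 (n := n).
have [i e] := integral_afft (- c) ltr01 gi.
under [X in mu.-integrable _ X]eq_fun do rewrite -afft1E.
under eq_Rintegral do rewrite -afft1E.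
split; first exact: i.
by rewrite e gE expr1n invr1 mul1r.
Qed.

(** Up to the factor [s], [phi] is the bounded limit of its Gaussian averages [K k]. By Fubini and
    evenness of the Gaussian, pairing [h] with such an average integrates [phi] against the Gaussian
    averages of [h], which vanish. *)
Lemma integral_gaussn_eq0_continuous (h : tupleR n -> R) :
  mu.-integrable setT (fun t => (h t)%:E) ->
  (forall k c, \int[mu]_t (h t * gaussn k.+1%:R (rowv t - c)) = 0) ->
  forall phi : 'rV[R]_n -> R, continuous phi -> (forall x, `|phi x| <= 1) ->
  \int[mu]_t (h t * phi (rowv t)) = 0.
Proof.
move=> hi h0 phi cphi phi1.
pose s := Num.sqrt (2 * pi) ^+ n : R.
have s0 : s != 0 by rewrite expf_neq0// gt_eqF// sqrtr_gt0 mulr_gt0// pi_gt0.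
have mh : measurable_fun setT h by case/integrableP : hi => /measurable_EFinP.
have mphi := measurable_continuous_rowv cphi.
pose F k (p : tupleR n * tupleR n) :=
  h p.1 * (phi (rowv p.2) * gaussn k.+1%:R (rowv p.2 - rowv p.1)).
have mg k : measurable_fun setT
    (fun p : tupleR n * tupleR n => gaussn k.+1%:R (rowv p.2 - rowv p.1)).
  have mg1 : measurable_fun setT (fun t : tupleR n => gaussn k.+1%:R (rowv t)).
    by have := measurable_gaussn k.+1%:R (0 : 'rV[R]_n); under eq_fun do rewrite subr0.
  under eq_fun do rewrite -gaussnN opprB -rowv_subt.
  exact: (measurableT_comp mg1 measurable_subt).
have mF k : measurable_fun setT (F k).
  apply: measurable_funM; first exact: measurableT_comp.
  apply: measurable_funM => //.
  exact: (measurableT_comp mphi measurable_snd).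
have Fi k : (mu \x mu)%E.-integrable setT (fun p => (F k p)%:E).
  apply/integrable12ltyP; first exact/measurable_EFinP.
  have hn := integrable_norm hi.
  have hni : (\int[mu]_t (`|h t|%:E * ((Num.sqrt (2 * pi) / k.+1%:R) ^+ n)%:E) < +oo)%E.
    have := integrableZr measurableT ((Num.sqrt (2 * pi) / k.+1%:R) ^+ n) hn.
    move/integrableP => [_]; apply: le_lt_trans.
    rewrite le_eqVlt; apply/orP; left; apply/eqP/eq_integral => x _ /=.
    rewrite normrM normr_id ger0_norm// exprn_ge0// divr_ge0 ?sqrtr_ge0//.
  apply: le_lt_trans hni; apply: ge0_le_integral => //.
  - by move=> x _; exact: integral_ge0.
  - have mFn : measurable_fun setT (fun p => `|(F k p)%:E|%E).
      by apply: measurableT_comp => //; exact/measurable_EFinP.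
    exact: (measurable_fun_fubini_tonelli_F _ mFn).
  - apply/measurable_EFinP; apply: measurable_funM => //.
    exact: measurableT_comp.
  move=> x _; have [gi gE] := integrable_gaussn_shift (rowv x) (ltr0Sn R k).
  rewrite -gE /Rintegral fineK; last exact: integrable_fin_num.
  rewrite -ge0_integralZl//; last 2 first.
  - by have /integrableP[] := gi.
  - by move=> y _; rewrite lee_fin gaussn_ge0.
  apply: ge0_le_integral => //.
  - apply: measurableT_comp => //; apply/measurable_EFinP.
    exact: (measurableT_comp (mF k) (measurable_pair1 x)).
  - apply/measurable_EFinP; apply: measurable_funM => //.
    exact: measurable_gaussn.
  move=> y _; rewrite -EFinM lee_fin /F/= !normrM ler_wpM2l//.
  by rewrite (ger0_norm (gaussn_ge0 _ _)) ler_piMl ?gaussn_ge0.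
pose K k x := k.+1%:R ^+ n *
  \int[mu]_t (phi (rowv t) * gaussn k.+1%:R (rowv t - rowv x)).
have hK k : \int[mu]_x (h x * K k x) = 0.
  have [_ e1 e2] := Rfubini (Fi k).
  transitivity (k.+1%:R ^+ n * \int[mu]_x \int[mu]_y F k (x, y)).
    rewrite -RintegralZl//; last by case: (Rfubini (Fi k)).
    apply: eq_Rintegral => x _; rewrite /K mulrCA; congr (_ * _).
    by rewrite -RintegralZl//; exact: (gaussn_approx_identity (rowv x) cphi phi1).1.
  rewrite e1 -e2; under eq_Rintegral => y _.
    rewrite (_ : \int[mu]_x _ = 0); first over.
    have -> : (fun x => F k (x, y)) =
        (fun x => phi (rowv y) * (h x * gaussn k.+1%:R (rowv x - rowv y))).
      by apply/funext => x; rewrite /F/= -gaussnN opprB; ring.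
    rewrite RintegralZl ?h0 ?mulr0//.
    apply: (Rintegrable_le (g := fun x => `|h x|)).
    - by apply: measurable_funM => //; exact: measurable_gaussn.
    - exact: integrable_norm hi.
    - by move=> x; rewrite normrM ler_piMr// ger0_norm ?gaussn_ge0 ?gaussn_le1.
  by rewrite Rintegral_cst// mul0r mulr0.
have mK k : measurable_fun setT (K k).
  apply: measurable_funM => //.
  (* [P] need not be integrable on the product, so measurability in [x] comes from Tonelli, applied
     to its positive and negative parts. *)
  pose P (p : tupleR n * tupleR n) :=
    (phi (rowv p.2) * gaussn k.+1%:R (rowv p.2 - rowv p.1))%:E.
  have mP : measurable_fun setT P.
    apply/measurable_EFinP; apply: measurable_funM => //.
    exact: (measurableT_comp mphi measurable_snd).
  rewrite (_ : (fun x => \int[mu]_t _) = fun x =>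
    fine (\int[mu]_t P^\+%E (x, t)) - fine (\int[mu]_t P^\-%E (x, t))); last first.
    apply/funext => x.
    have ai := (gaussn_approx_identity (rowv x) cphi phi1).1 k.
    rewrite /Rintegral integralE fineB.
    + by rewrite (funepos_comp P (pair x)) (funeneg_comp P (pair x)).
    + exact: (integrable_pos_fin_num measurableT ai).
    + exact: (integrable_neg_fin_num measurableT ai).
  apply: measurable_funB; apply: measurableT_comp => //.
  - by apply: measurable_fun_fubini_tonelli_F => //; exact: measurable_funepos.
  - by apply: measurable_fun_fubini_tonelli_F => //; exact: measurable_funeneg.
have hKl : \int[mu]_x (h x * K k x) @[k --> \oo] --> \int[mu]_x (h x * (s * phi (rowv x))).
  apply: (@Rdominated_convergence _ _ _ mu (fun k x => h x * K k x) _
    (fun x => `|h x| * s) _ _ _ _).2.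
  - by move=> k; exact: measurable_funM.
  - move=> x; apply: cvgM; first exact: cvg_cst.
    exact: (gaussn_approx_identity (rowv x) cphi phi1).2.2.
  - under eq_fun do rewrite EFinM; apply: integrableZr => //.
    exact: integrable_norm hi.
  - move=> k x; rewrite normrM ler_wpM2l//.
    by have := (gaussn_approx_identity (rowv x) cphi phi1).2.1 k; rewrite mul1r.
have hK0 : \int[mu]_x (h x * K k x) @[k --> \oo] --> (0 : R).
  by under eq_fun do rewrite hK; exact: cvg_cst.
have : \int[mu]_x (h x * (s * phi (rowv x))) = 0 by exact: (cvg_unique _ hKl hK0).
under eq_Rintegral do rewrite mulrCA.
rewrite RintegralZl//.
  by move/eqP; rewrite mulf_eq0 (negbTE s0)/= => /eqP.
apply: (Rintegrable_le (g := fun x => `|h x|)).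
- exact: measurable_funM.
- exact: integrable_norm hi.
- by move=> x; rewrite normrM ler_piMr.
Qed.

(* Sets whose indicator is a pointwise limit of continuous [0, 1]-valued
   functions: a pi-system generating the Borel sets. *)
Let G : set (set (tupleR n)) := [set A | measurable A /\
  exists phi : nat -> 'rV[R]_n -> R, [/\ forall k, continuous (phi k),
   forall k x, 0 <= phi k x <= 1 &
   forall t, phi k (rowv t) @[k --> \oo] --> (\1_A t : R)]].

Let G_setI : setI_closed G.
Proof.
move=> A B [mA [phi [cphi phi1 phil]]] [mB [psi [cpsi psi1 psil]]].
split; first exact: measurableI.
exists (fun k x => phi k x * psi k x); split => [k x|k x|t].
- exact: continuousM (cphi k x) (cpsi k x).
- have /andP[? ?] := phi1 k x; have /andP[? ?] := psi1 k x.
  by rewrite mulr_ge0//= mulr_ile1.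
- by rewrite indicI; apply: cvgM; [exact: phil|exact: psil].
Qed.

Let G_ray (i : 'I_n) (a : R) : G [set t | a < tnth t i].
Proof.
split.
  rewrite (_ : [set t | _] = (fun t : tupleR n => tnth t i) @^-1` `]a, +oo[).
    by rewrite -[X in measurable X]setTI; exact: (@measurable_tnth _ _ n i).
  by apply/seteqP; split => t /=; rewrite in_itv/= andbT.
(* [d] is twice the positive part of [x_i - a]; [1 - exp (- k d)] vanishes where [d = 0] and tends
   to 1 where [d > 0]. *)
pose d (x : 'rV[R]_n) : R := `|x ord0 i - a| + (x ord0 i - a).
have d0 x : 0 <= d x by rewrite /d -lerBlDr sub0r -normrN ler_norm.
have cd : continuous d.
  have cc : continuous (fun x : 'rV[R]_n => x ord0 i - a).
    exact: hasgrad_continuous (hasgradD (hasgrad_coord i) (hasgrad_cst (- a))).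
  have cn : continuous (fun x : 'rV[R]_n => `|x ord0 i - a|).
    move=> x; apply: (@continuous_comp _ _ _
      (fun x : 'rV[R]_n => x ord0 i - a) (@Num.norm _ R) x (cc x)).
    exact: norm_continuous.
  move=> x; exact: (@continuousD _ _ _ _ (fun x : 'rV[R]_n => x ord0 i - a) x (cn x) (cc x)).
exists (fun k x => 1 - expR (- d x) ^+ k); split => [k x|k x|t].
- apply: (@continuous_comp _ _ _ d (fun y : R => 1 - expR (- y) ^+ k) x (cd x)).
  apply: cvgB; first exact: cvg_cst.
  apply: (@continuous_comp _ _ _ (fun y : R => expR (- y)) (fun y => y ^+ k)).
    apply: (@continuous_comp _ _ _ (fun y : R => - y) expR).
      exact: oppr_continuous.
    exact: continuous_expR.
  exact: exprn_continuous.
- have e1 : expR (- d x) <= 1 by rewrite -expR0 ler_expR oppr_le0.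
  have e0 := expR_ge0 (- d x).
  rewrite lerBlDr lerDl exprn_ge0// subr_ge0 exprn_ile1//.
have [ta|ta] := ltP a (tnth t i).
  rewrite indicE mem_set// -[X in _ --> X]subr0.
  apply: cvgB; first exact: cvg_cst.
  apply: cvg_expr; rewrite ger0_norm ?expR_ge0//.
  by rewrite expR_lt1 oppr_lt0 /d mxE ltr_wpDl// subr_gt0.
rewrite indicE memNset/=; last by apply/negP; rewrite -leNgt.
rewrite (_ : d (rowv t) = 0); last first.
  by rewrite /d mxE ler0_norm ?subr_le0// addNr.
by rewrite oppr0 expR0; under eq_fun do rewrite expr1n subrr; exact: cvg_cst.
Qed.

(** The rays make every coordinate measurable for [<<s G>>], and the coordinates generate the
    sigma-algebra of tuples. *)
Let G_measurable : @measurable _ (tupleR n) = <<s G >>.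
Proof.
apply/seteqP; split; last first.
  by apply: smallest_sub; [exact: sigma_algebra_measurable|move=> A []].
have : measurable_fun [set: g_sigma_algebraType G]
    (id : g_sigma_algebraType G -> tupleR n).
  apply/measurable_fun_tnthP => i.
  apply: (measurability _ (RGenOInfty.measurableE R)) => //.
  move=> _ [_ [x ->] <-]; rewrite setTI; apply: sub_sigma_algebra.
  rewrite (_ : _ @^-1` _ = [set t | x < tnth t i]); first exact: G_ray.
  by apply/seteqP; split => t /=; rewrite in_itv/= andbT.
by move=> mid A mA; have := mid measurableT A mA; rewrite setTI.
Qed.

(** Dominated convergence gives zero integrals over the sets of [G], Dynkin's theorem over all
    measurable sets, and this forces [h] to vanish almost everywhere. *)
Lemma integral_continuous_eq0_ae (h : tupleR n -> R) :
  mu.-integrable setT (fun t => (h t)%:E) ->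
  (forall phi : 'rV[R]_n -> R, continuous phi -> (forall x, `|phi x| <= 1) ->
    \int[mu]_t (h t * phi (rowv t)) = 0) ->
  ae_eq mu setT h (cst 0).
Proof.
move=> hi h0.
have mh : measurable_fun setT h by case/integrableP : hi => /measurable_EFinP.
have hiA A : measurable A -> mu.-integrable A (fun t => (h t)%:E).
  by move=> mA; exact: (integrableS measurableT mA _ hi).
have IG A : G A -> (\int[mu]_(t in A) (h t)%:E = 0)%E.
  move=> [mA [phi [cphi phi1 phil]]].
  have phi1' k x : `|phi k x| <= 1.
    by have /andP[p0 p1] := phi1 k x; rewrite ger0_norm.
  rewrite integral_mkcond.
  rewrite (_ : _ \_ A = fun t => (h t * \1_A t)%:E); last first.
    apply/funext => t; rewrite patchE indicE.
    by case: (t \in A); rewrite ?mulr1 ?mulr0.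
  have [i c] : mu.-integrable setT (fun t => (h t * \1_A t)%:E) /\
      \int[mu]_t (h t * phi k (rowv t)) @[k --> \oo] --> \int[mu]_t (h t * \1_A t).
    apply: (Rdominated_convergence (g := fun t => `|h t|)).
    - move=> k; apply: measurable_funM => //.
      exact: measurable_continuous_rowv.
    - by move=> t; apply: cvgM; [exact: cvg_cst|exact: phil].
    - exact: integrable_norm hi.
    - by move=> k t; rewrite normrM ler_piMr.
  have c0 : \int[mu]_t (h t * phi k (rowv t)) @[k --> \oo] --> (0 : R).
    under eq_fun do rewrite (h0 _ (cphi _) (phi1' _)).
    exact: cvg_cst.
  have := cvg_unique _ c c0.
  rewrite /Rintegral => e; rewrite -[LHS]fineK ?e//.
  exact: (integrable_fin_num measurableT i).
have IA A : measurable A -> (\int[mu]_(t in A) (h t)%:E = 0)%E.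
  move=> mA; rewrite G_measurable in mA.
  (* Complements need the integral over the whole space, which is the case [phi = 1]. *)
  have IT : (\int[mu]_t (h t)%:E = 0)%E.
    have c1 (x : 'rV[R]_n) : `|cst 1 x| <= 1 :> R by rewrite normr1.
    have := h0 (cst 1) (@cst_continuous _ _ _) c1.
    under eq_Rintegral do rewrite mulr1.
    rewrite /Rintegral => e; rewrite -[LHS]fineK ?e//.
    exact: (integrable_fin_num measurableT hi).
  move: A mA; apply: (dynkin_induction G_measurable G_setI) => //.
  - move=> A mA A0.
    have := integral_setU mu mA (measurableC mA) (f := fun t => (h t)%:E).
    rewrite setUv A0 add0e IT => <- //.
    + exact/measurable_EFinP.
    + by rewrite /disj_set setICr.
  - move=> F mF tF F0.
    rewrite integral_bigcup//; last by apply: hiA; exact: bigcupT_measurable.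
    by rewrite eseries0.
have := @integral_ae_eq _ _ _ mu setT measurableT (fun=> 0%E) (fun t => (h t)%:E)
  hi (measurable_cst _).
move=> /(_ _)[].
  by move=> E _ mE; rewrite IA// integral0.
move=> N [mN N0 sN]; exists N; split => //; apply: subset_trans sN => t /=.
by apply: contra_not => /(_ I) [].
Qed.

Lemma cint_gaussn_eq0_ae (h : tupleR n -> R[i]) : cintble mu h ->
  (forall r c, 0 < r -> cint mu (fun t => h t * (gaussn r (rowv t - c))%:C) = 0) ->
  ae_eq mu setT h (cst 0).
Proof.
move=> [rh jh] h0.
have R0 : ae_eq mu setT (fun t => Re (h t)) (cst 0).
  apply: integral_continuous_eq0_ae => //.
  apply: integral_gaussn_eq0_continuous => // k c.
  by have := congr1 (@complex.Re R) (h0 k.+1%:R c (ltr0Sn _ _)); rewrite Re_cintM_real.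
have I0 : ae_eq mu setT (fun t => Im (h t)) (cst 0).
  apply: integral_continuous_eq0_ae => //.
  apply: integral_gaussn_eq0_continuous => // k c.
  by have := congr1 (@complex.Im R) (h0 k.+1%:R c (ltr0Sn _ _)); rewrite Im_cintM_real.
move: R0 I0; apply: filterS2 => t r0 i0 _; apply: eq_complexP.
- by rewrite r0.
- by rewrite i0.
Qed.

End uniqueness.

(** * Fourier inversion and convolution *)

Section inversion.
Context {R : realType} {n : nat}.
Local Notation tupleR n := (n.-tuple (measurableTypeR R)).
Local Notation mu := (lebesgueRn R n).
Local Notation Rn := 'rV[R]_n.

Lemma sqrt2pi_gt0 : 0 < Num.sqrt (2 * pi) :> R.
Proof. by rewrite sqrtr_gt0 mulr_gt0// pi_gt0. Qed.

(** With the kernel [e^{-i x.xi}] the centre is [- c], against [c] for the opposite sign in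
    [cint_mgauss]; hence the choice of [- x0] in [fourier_inversion]. *)
Lemma fourier_mgauss (r : R) (c : Rn) : 0 < r ->
  fourier (mgauss r c) =
  fun xi => ((Num.sqrt (2 * pi) / r) ^+ n * gaussn r^-1 (xi + c))%:C.
Proof.
move=> r0; apply/funext => xi; have [_ e] := cint_mgauss c r0 (- xi).
rewrite -[X in gaussn _ X]opprK gaussnN opprD -e.
by apply: eq_cint => t; rewrite dotNr.
Qed.

Lemma Cb_measurable (f : Rn -> R[i]) : Cb f -> cmeasurable (fun t : tupleR n => f (rowv t)).
Proof. by move=> [rf jf _]; split; [exact: measurable_continuous_rowv rf|
  exact: measurable_continuous_rowv jf]. Qed.

Lemma Cb_cintble (f : Rn -> R[i]) (g : tupleR n -> R[i]) : Cb f -> cintble mu g ->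
  cintble mu (fun t => f (rowv t) * g t).
Proof.
move=> fb; have [_ _ [M fM]] := fb.
apply: (@cintble_bounded _ _ _ _ _ _ M); first exact: Cb_measurable.
by move=> t; exact: fM.
Qed.

Lemma cmeasurable_expi_dot (c : Rn) :
  cmeasurable (fun t : tupleR n => expi (dot (rowv t) c)).
Proof. by apply: cmeasurable_expi; exact: measurable_dotr. Qed.

Lemma cintble_expi (c : Rn) (g : tupleR n -> R[i]) : cintble mu g ->
  cintble mu (fun t => expi (dot (rowv t) c) * g t).
Proof.
apply: (@cintble_bounded _ _ _ _ _ _ 1); first exact: cmeasurable_expi_dot.
by move=> t; rewrite normc_expi.
Qed.

Lemma cvg_gaussn_1 (x : Rn) : gaussn k.+1%:R^-1 x @[k --> \oo] --> (1 : R).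
Proof.
have g0 : gaussn 1 (0 : Rn) = 1 :> R.
  by rewrite -(scale0r (0 : Rn)) gaussnZ mulr0 /gaussn expr0n !mul0r oppr0 expR0.
have cg := @hasgrad_continuous R n _ _ (@hasgrad_gaussn R n 1) (0 : Rn).
have := cvg_comp _ (gaussn 1) (@cvg_rowv_affine R n x 0) cg.
rewrite g0 (_ : gaussn 1 \o _ = fun k => gaussn k.+1%:R^-1 x)//.
by apply/funext => k /=; rewrite addr0 gaussnZ mul1r.
Qed.

(** The test function is [mgauss k.+1%:R^-1 (- x0)]. On the side of [f] its transform is an
    approximate identity at [x0]; on the side of [g] it tends itself to [e^{i x.x0}]. Continuity of
    [f] gives the identity at every point. *)
Lemma fourier_inversion (f g : Rn -> R[i]) : Cb f -> is_fourier f g ->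
  forall x0, cint mu (fun t => expi (dot (rowv t) x0) * g (rowv t)) =
    ((2 * pi) ^+ n)%:C * f x0.
Proof.
move=> fb [gi fg] x0; have [cr cj [M fM]] := fb.
pose s := Num.sqrt (2 * pi) : R.
(* One factor [s ^+ n] comes from the Fourier integral of the Gaussian, the other from the mass of
   the approximate identity. *)
have ss : s ^+ n * s ^+ n = (2 * pi) ^+ n.
  by rewrite -exprMn -expr2 sqr_sqrtr// mulr_ge0// pi_ge0.
pose h t := expi (dot (rowv t) x0) * g (rowv t) : R[i].
have hi : cintble mu h by exact: cintble_expi.
have key k :
    cint mu (fun t => f (rowv t) * (s ^+ n * k.+1%:R ^+ n *
       gaussn k.+1%:R (rowv t - x0))%:C) =
    cint mu (fun t => h t * (gaussn k.+1%:R^-1 (rowv t))%:C).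
  have k0 : 0 < (k.+1%:R^-1 : R) by rewrite invr_gt0.
  have := fg _ (schwartz_mgauss (- x0) k0).
  rewrite /fourier_distribution fourier_mgauss// invrK => e.
  transitivity (distribution_of g (mgauss k.+1%:R^-1 (- x0))); last first.
    apply: eq_cint => t; rewrite /mgauss /h dotNr opprK; ring.
  by rewrite -e; apply: eq_cint => t; rewrite exprMn.
(* [P] stands for [Re] and for [Im], which share the passage to the limit. *)
have lim (P : R[i] -> R) :
    (forall (z : R[i]) (a : R), P (z * a%:C) = P z * a) ->
    (forall z, `|P z| <= normc z) ->
    continuous (fun x => P (f x)) ->
    measurable_fun setT (fun t => P (h t)) ->
    (forall k, \int[mu]_t P (f (rowv t) * (s ^+ n * k.+1%:R ^+ n *
       gaussn k.+1%:R (rowv t - x0))%:C) =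
    \int[mu]_t P (h t * (gaussn k.+1%:R^-1 (rowv t))%:C)) ->
    \int[mu]_t P (h t) = (2 * pi) ^+ n * P (f x0).
  move=> PZ Pn cP mP Pkey.
  have PM x : `|P (f x)| <= M by exact: le_trans (Pn _) (fM x).
  have [ai [_ al]] := gaussn_approx_identity x0 cP PM.
  have L1 : \int[mu]_t P (f (rowv t) * (s ^+ n * k.+1%:R ^+ n *
       gaussn k.+1%:R (rowv t - x0))%:C) @[k --> \oo] --> (2 * pi) ^+ n * P (f x0).
    rewrite -ss -mulrA.
    have -> : (fun k => \int[mu]_t P (f (rowv t) * (s ^+ n * k.+1%:R ^+ n *
       gaussn k.+1%:R (rowv t - x0))%:C)) = (fun k => s ^+ n * (k.+1%:R ^+ n *
         \int[mu]_t (P (f (rowv t)) * gaussn k.+1%:R (rowv t - x0)))).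
      apply/funext => k; rewrite mulrA -RintegralZl//; last exact: ai.
      by apply: eq_Rintegral => t _; rewrite PZ mulrCA.
    by apply: cvgM; [exact: cvg_cst|exact: al].
  have L2 : \int[mu]_t P (h t * (gaussn k.+1%:R^-1 (rowv t))%:C) @[k --> \oo] -->
      \int[mu]_t P (h t).
    under eq_fun do under eq_Rintegral do rewrite PZ.
    apply: (@Rdominated_convergence _ _ _ mu
      (fun k t => P (h t) * gaussn k.+1%:R^-1 (rowv t)) _ (fun t => normc (h t)) _ _ _ _).2.
    - move=> k; apply: measurable_funM => //.
      by have := measurable_gaussn k.+1%:R^-1 (0 : Rn); under eq_fun do rewrite subr0.
    - move=> t; rewrite -[X in _ --> X]mulr1; apply: cvgM; first exact: cvg_cst.
      exact: cvg_gaussn_1.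
    - exact: cintble_normc.
    - move=> k t; rewrite normrM (le_trans _ (Pn _))// ler_piMr//.
      by rewrite ger0_norm ?gaussn_ge0 ?gaussn_le1.
  rewrite (_ : (fun k => \int[mu]_t P (f (rowv t) * _)) =
    (fun k => \int[mu]_t P (h t * (gaussn k.+1%:R^-1 (rowv t))%:C))) in L1; last first.
    by apply/funext => k; exact: Pkey.
  exact: (cvg_unique _ L2 L1).
have [mr mj] := cintble_measurable hi.
apply: eq_complexP.
- rewrite Re_cint [RHS]RecM [Re _%:C]/= [Im _%:C]/= mul0r subr0; apply: lim => //.
  + by move=> z a; rewrite RecM /= mulr0 subr0.
  + exact: Re_le_normc.
  + by move=> k; have /(congr1 (@complex.Re R)) := key k.
- rewrite Im_cint [RHS]ImcM [Re _%:C]/= [Im _%:C]/= mul0r addr0; apply: lim => //.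
  + by move=> z a; rewrite ImcM /= mulr0 add0r.
  + exact: Im_le_normc.
  + by move=> k; have /(congr1 (@complex.Im R)) := key k.
Qed.

Lemma dot_rowv_measurable : measurable_fun setT
  (fun p : tupleR n * tupleR n => dot (rowv p.1) (rowv p.2)).
Proof.
rewrite /dot; apply: measurable_sum => i.
under eq_fun do rewrite !mxE.
by apply: measurable_funM; apply: (measurableT_comp (measurable_tnth i)).
Qed.

(** Symmetry of the Fourier integral on [L^1]: Fubini applies because the phase is bounded. *)
Lemma cint_expi_adjoint (g chi : tupleR n -> R[i]) :
  cintble mu g -> cintble mu chi ->
  cint mu (fun x => cint mu (fun y => expi (dot (rowv y) (rowv x)) * g y) * chi x) =
  cint mu (fun y => g y * cint mu (fun x => expi (dot (rowv x) (rowv y)) * chi x)).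
Proof.
move=> gi ci.
pose F (p : tupleR n * tupleR n) := expi (dot (rowv p.1) (rowv p.2)) *
  (chi p.1 * g p.2).
have Fi : cintble (mu \x mu)%E F.
  apply: (@cintble_bounded _ _ _ _ _ _ 1).
  - by apply: cmeasurable_expi; exact: dot_rowv_measurable.
  - by move=> p; rewrite normc_expi.
  - exact: cintble_prod.
transitivity (cint mu (fun x => cint mu (fun y => F (x, y)))).
  apply: eq_cint => x; rewrite mulrC -cintZ; last exact: cintble_expi.
  by apply: eq_cint => y; rewrite /F/= dotC mulrCA.
rewrite (cfubini Fi); apply: eq_cint => y; rewrite -cintZ; last exact: cintble_expi.
by apply: eq_cint => x; rewrite /F/=; ring.
Qed.

Lemma cintble_expi_pairing (g chi : tupleR n -> R[i]) :
  cintble mu g -> cintble mu chi ->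
  cintble mu (fun y => g y * cint mu (fun x => expi (dot (rowv x) (rowv y)) * chi x)).
Proof.
move=> gi ci.
pose F (p : tupleR n * tupleR n) := expi (dot (rowv p.1) (rowv p.2)) *
  (g p.1 * chi p.2).
have Fi : cintble (mu \x mu)%E F.
  apply: (@cintble_bounded _ _ _ _ _ _ 1).
  - by apply: cmeasurable_expi; exact: dot_rowv_measurable.
  - by move=> p; rewrite normc_expi.
  - exact: cintble_prod.
have := cintble_fubini Fi; congr (cintble mu _); apply/funext => y.
rewrite -cintZ; last exact: cintble_expi.
by apply: eq_cint => x; rewrite /F/= dotC mulrCA.
Qed.

Lemma mgauss_cintble (r : R) (c : Rn) : 0 < r ->
  cintble mu (fun t => mgauss r c (rowv t)).
Proof.
move=> r0; have [+ _] := cint_mgauss c r0 (0 : Rn).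
congr (cintble mu _); apply/funext => t.
by rewrite -(scale0r (0 : Rn)) dotC dotZl mul0r expi0 mul1r.
Qed.

Lemma laplacian_mgauss_cintble (r : R) (c : Rn) : 0 < r ->
  cintble mu (fun t => laplacian (mgauss r c) (rowv t)).
Proof.
move=> r0; have [+ _] := cint_laplacian_mgauss c r0 (0 : Rn).
congr (cintble mu _); apply/funext => t.
by rewrite -(scale0r (0 : Rn)) dotC dotZl mul0r expi0 mul1r.
Qed.

(** By inversion both representatives have the same Fourier integral everywhere; moving the
    transform of their difference onto modulated Gaussians shows that its Gaussian averages
    vanish. *)
Lemma is_fourier_unique (f g1 g2 : Rn -> R[i]) : Cb f ->
  is_fourier f g1 -> is_fourier f g2 ->
  ae_eq mu setT (fun t => g1 (rowv t)) (fun t => g2 (rowv t)).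
Proof.
move=> fb f1 f2.
have g1i : cintble mu (fun t => g1 (rowv t)) by case: f1.
have g2i : cintble mu (fun t => g2 (rowv t)) by case: f2.
pose h (t : tupleR n) := g1 (rowv t) - g2 (rowv t).
have hi : cintble mu h by exact: cintbleB.
have h0 (x : Rn) : cint mu (fun t => expi (dot (rowv t) x) * h t) = 0.
  rewrite /h; under eq_cint => t do rewrite mulrBr.
  rewrite cintB; [|exact: cintble_expi..].
  by rewrite (fourier_inversion fb f1) (fourier_inversion fb f2) subrr.
suff : ae_eq mu setT h (cst 0).
  by apply: filterS => t ht _; apply/eqP; rewrite -subr_eq0; apply/eqP; exact: ht.
apply: cint_gaussn_eq0_ae => // r c r0.
(* Parameter [r^-1] for the test function, so that its Fourier integral is a multiple of
   [gaussn r]. *)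
have ri0 : 0 < r^-1 by rewrite invr_gt0.
have := cint_expi_adjoint hi (mgauss_cintble c ri0).
under [X in cint _ X = _]eq_fun do rewrite h0 mul0r.
rewrite cint0; under [X in _ = cint _ X]eq_fun do
  rewrite (cint_mgauss c ri0 _).2 invrK real_complexM mulrCA.
rewrite cintZ; last first.
  under eq_fun do rewrite mulrC; apply: (@cintble_bounded _ _ _ _ _ _ 1) => //.
  - by apply: cmeasurable_real; exact: measurable_gaussn.
  - by move=> t; rewrite normc_real ger0_norm ?gaussn_ge0 ?gaussn_le1.
move/esym/eqP; rewrite mulf_eq0 => /orP[|/eqP //].
rewrite eq_complex /= eqxx andbT expf_eq0 mulf_eq0 gt_eqF ?sqrt2pi_gt0//=.
by rewrite gt_eqF// andbF.
Qed.

End inversion.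

Section convolution.
Context {R : realType} {n : nat}.
Local Notation tupleR n := (n.-tuple (measurableTypeR R)).
Local Notation mu := (lebesgueRn R n).
Local Notation Rn := 'rV[R]_n.

Lemma measurable_rowvB (f : Rn -> R) :
  measurable_fun setT (fun t : tupleR n => f (rowv t)) ->
  measurable_fun setT (fun p : tupleR n * tupleR n => f (rowv p.1 - rowv p.2)).
Proof.
move=> mf; under eq_fun do rewrite -rowv_subt.
exact: (measurableT_comp mf measurable_subt).
Qed.

(** Tonelli, then the translation [t |-> t + s], under which the measure is invariant. *)
Lemma integral_convolution (w a b : Rn -> R) :
  (forall x, 0 <= w x) -> (forall x, 0 <= a x) -> (forall x, 0 <= b x) ->
  measurable_fun setT (fun t : tupleR n => w (rowv t)) ->
  measurable_fun setT (fun t : tupleR n => a (rowv t)) ->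
  measurable_fun setT (fun t : tupleR n => b (rowv t)) ->
  (\int[mu]_t ((w (rowv t))%:E * \int[mu]_s (a (rowv s) * b (rowv t - rowv s))%:E) =
   \int[mu]_s \int[mu]_t (w (rowv t + rowv s) * (a (rowv s) * b (rowv t)))%:E)%E.
Proof.
move=> w0 a0 b0 mw ma mb.
pose F (p : tupleR n * tupleR n) :=
  (w (rowv p.1) * (a (rowv p.2) * b (rowv p.1 - rowv p.2)))%:E.
have mF : measurable_fun setT F.
  apply/measurable_EFinP; apply: measurable_funM.
    exact: (measurableT_comp mw measurable_fst).
  apply: measurable_funM; last exact: measurable_rowvB.
  exact: (measurableT_comp ma measurable_snd).
have F0 p : (0 <= F p)%E by rewrite lee_fin !mulr_ge0.
transitivity (\int[mu]_t \int[mu]_s F (t, s))%E.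
  apply: eq_integral => t _; rewrite -ge0_integralZl//.
  - apply/measurable_EFinP; apply: measurable_funM => //.
    exact: (measurableT_comp (measurable_rowvB mb) (measurable_pair1 t)).
  - by move=> s _; rewrite lee_fin mulr_ge0.
  - by rewrite lee_fin.
have := fubini_tonelli (m1 := mu) (m2 := mu) F mF F0.
rewrite /fubini_F /fubini_G => ->.
apply: eq_integral => s _.
rewrite -[LHS]mul1e -[X in X%:E]invr1 -{1}(expr1n R n).
rewrite -(@ge0_integral_afft R n 1 (rowv s) (fun t => F (t, s)))//; last first.
  exact: (measurableT_comp mF (measurable_pair2 s)).
by apply: eq_integral => t _; rewrite /F/= afft1E addrK.
Qed.

Variables g h : Rn -> R[i].
Hypothesis gi : cintble mu (fun t => g (rowv t)).
Hypothesis hi : cintble mu (fun t => h (rowv t)).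

Definition conv_kernel (p : tupleR n * tupleR n) : R[i] :=
  g (rowv p.2) * h (rowv p.1 - rowv p.2).

Definition convol (t : tupleR n) : R[i] := cint mu (fun s => conv_kernel (t, s)).

Lemma cmeasurable_conv_kernel : cmeasurable conv_kernel.
Proof.
apply: cmeasurableM.
  exact: (cmeasurable_comp (cintble_measurable gi) measurable_snd).
have [rh jh] := cintble_measurable hi.
by split; [exact: (@measurable_rowvB (fun x => Re (h x)) rh)|
  exact: (@measurable_rowvB (fun x => Im (h x)) jh)].
Qed.

Lemma cintble_conv_kernel : cintble (mu \x mu)%E conv_kernel.
Proof.
have mk := cmeasurable_conv_kernel; apply/cintbleP; split => //.
have mkn : measurable_fun setT (fun p => (normc (conv_kernel p))%:E).
  by apply/measurable_EFinP; exact: measurable_normc.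
have k0 p : (0 <= (normc (conv_kernel p))%:E)%E by rewrite lee_fin normc_ge0.
rewrite (fubini_tonelli1 (m1 := mu) (m2 := mu) _ mkn k0) /fubini_F/=.
have mgn := measurable_normc (cintble_measurable gi).
have mhn := measurable_normc (cintble_measurable hi).
have := @integral_convolution (fun=> 1) (fun x => normc (g x)) (fun x => normc (h x))
  (fun=> ler01) (fun=> normc_ge0 _) (fun=> normc_ge0 _) (measurable_cst _) mgn mhn.
under eq_integral => t _.
  rewrite mul1e; under eq_integral do rewrite -Normc.normcM; over.
rewrite /conv_kernel/= => ->.
under eq_integral => s _.
  under eq_integral do rewrite mul1r EFinM.
  rewrite ge0_integralZl//; last 3 first.
  - exact/measurable_EFinP.
  - by move=> t _; rewrite lee_fin normc_ge0.
  - by rewrite lee_fin normc_ge0.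
  over.
have [_ gf] := (cintbleP _ _).1 gi; have [_ hf] := (cintbleP _ _).1 hi.
have g0 : (0 <= \int[mu]_t (normc (g (rowv t)))%:E)%E.
  by apply: integral_ge0 => t _; rewrite lee_fin normc_ge0.
have h0 : (0 <= \int[mu]_t (normc (h (rowv t)))%:E)%E.
  by apply: integral_ge0 => t _; rewrite lee_fin normc_ge0.
rewrite ge0_integralZr//.
- by rewrite lte_mul_pinfty// ge0_fin_numE.
- exact/measurable_EFinP.
- by move=> t _; rewrite lee_fin normc_ge0.
Qed.

Lemma cintble_convol : cintble mu convol.
Proof. exact: cintble_fubini cintble_conv_kernel. Qed.

Lemma cint_convol (phi : Rn -> R) (M : R) :
  measurable_fun setT (fun t : tupleR n => phi (rowv t)) ->
  (forall x, `|phi x| <= M) ->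
  cint mu (fun t => convol t * (phi (rowv t))%:C) =
  cint mu (fun s => g (rowv s) *
    cint mu (fun t => h (rowv t) * (phi (rowv t + rowv s))%:C)).
Proof.
move=> mphi phiM.
pose F (p : tupleR n * tupleR n) := (phi (rowv p.1))%:C * conv_kernel p.
have Fi : cintble (mu \x mu)%E F.
  apply: (@cintble_bounded _ _ _ _ _ _ M).
  - apply: cmeasurable_real; exact: (measurableT_comp mphi measurable_fst).
  - by move=> p; rewrite normc_real.
  - exact: cintble_conv_kernel.
have hsi s : cintble mu (fun t => h (rowv t - rowv s)) /\
    forall k : tupleR n -> R[i], cintble mu k ->
    cint mu (fun t => k (afft 1 (rowv s) t)) = cint mu k.
  split.
    have [+ _] := cint_afft (- rowv s) (@ltr01 R) hi.
    by under eq_fun do rewrite afft1E.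
  move=> k ki; have [_ ->] := cint_afft (rowv s) (@ltr01 R) ki.
  by rewrite expr1n invr1 mul1r.
have phihi s : cintble mu (fun t => h (rowv t - rowv s) * (phi (rowv t))%:C).
  under eq_fun do rewrite mulrC.
  apply: (@cintble_bounded _ _ _ _ _ _ M); last exact: (hsi s).1.
  - exact: cmeasurable_real.
  - by move=> p; rewrite normc_real.
have rhs s : cint mu (fun t => h (rowv t) * (phi (rowv t + rowv s))%:C) =
    cint mu (fun t => h (rowv t - rowv s) * (phi (rowv t))%:C).
  rewrite -((hsi s).2 _ (phihi s)); apply: eq_cint => t.
  by rewrite afft1E addrK.
transitivity (cint mu (fun t => cint mu (fun s => F (t, s)))).
  (* [phi] moves under the inner integral where the section of the kernel is integrable, which is
     known for almost every [t] only. *)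
  apply: ae_eq_cint.
  - apply: cmeasurableM; last exact: cmeasurable_real.
    exact: cintble_measurable cintble_convol.
  - exact: cintble_measurable (cintble_fubini Fi).
  have := cintble_section_ae cintble_conv_kernel; apply: filterS => t ti _.
  by rewrite mulrC /convol -cintZ.
rewrite (cfubini Fi); apply: eq_cint => s; rewrite rhs -cintZ//.
by apply: eq_cint => t; rewrite /F/conv_kernel/=; ring.
Qed.

End convolution.

(** * The equation on the Fourier side *)

Section fourier_side_equation.
Context {R : realType} {n : nat}.
Local Notation tupleR n := (n.-tuple (measurableTypeR R)).
Local Notation mu := (lebesgueRn R n).
Local Notation Rn := 'rV[R]_n.
Local Notation A := ((2 * pi) ^+ n)%:C.

(** Inversion and Fubini extend the defining identity of the transform from Schwartz functions to
    every integrable [chi], in particular to the products [u phi] used below. *)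
Lemma cint_fourier_pairing (f g : Rn -> R[i]) (chi : tupleR n -> R[i]) :
  Cb f -> is_fourier f g -> cintble mu chi ->
  A * cint mu (fun t => f (rowv t) * chi t) =
  cint mu (fun s => g (rowv s) * cint mu (fun t => expi (dot (rowv t) (rowv s)) * chi t)).
Proof.
move=> fb fg ci; have gi : cintble mu (fun t => g (rowv t)) by case: fg.
rewrite -cintZ; last exact: Cb_cintble.
rewrite -cint_expi_adjoint//; apply: eq_cint => t.
by rewrite (fourier_inversion fb fg) mulrA.
Qed.

Variables V f u v fh uh : Rn -> R[i].
Hypotheses (Vb : Cb V) (fb : Cb f) (ub : Cb u).
Hypotheses (Vv : is_fourier V v) (ffh : is_fourier f fh) (uuh : is_fourier u uh).
Hypothesis uh2 : cintble mu (fun t => (jbracket (rowv t) ^+ 2)%:C * uh (rowv t)).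
Hypothesis Vfu : solves V f u.

Let vi : cintble mu (fun t => v (rowv t)). Proof. by case: Vv. Qed.
Let fhi : cintble mu (fun t => fh (rowv t)). Proof. by case: ffh. Qed.
Let uhi : cintble mu (fun t => uh (rowv t)). Proof. by case: uuh. Qed.

Section test_function.
Variables (r : R) (c : Rn).
Hypothesis r0 : 0 < r.
Let Phi (x : Rn) : R := (Num.sqrt (2 * pi) / r) ^+ n * gaussn r^-1 (x - c).
Let phi (t : tupleR n) : R[i] := mgauss r c (rowv t).
Let lphi (t : tupleR n) : R[i] := laplacian (mgauss r c) (rowv t).

Let phii : cintble mu phi. Proof. exact: mgauss_cintble. Qed.
Let lphii : cintble mu lphi. Proof. exact: laplacian_mgauss_cintble. Qed.

Let phiE (x : Rn) : cint mu (fun t => expi (dot (rowv t) x) * phi t) = (Phi x)%:C.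
Proof. exact: (cint_mgauss c r0 x).2. Qed.

Let lphiE (x : Rn) :
  cint mu (fun t => expi (dot (rowv t) x) * lphi t) = (- dot x x)%:C * (Phi x)%:C.
Proof. by rewrite (cint_laplacian_mgauss c r0 x).2 phiE. Qed.

Let mPhi : measurable_fun setT (fun t : tupleR n => Phi (rowv t)).
Proof. by apply: measurable_funM => //; exact: measurable_gaussn. Qed.

Let K0 : 0 <= (Num.sqrt (2 * pi) / r) ^+ n.
Proof. by rewrite exprn_ge0// divr_ge0 ?(ltW r0)// ltW// sqrt2pi_gt0. Qed.

Let PhiM x : `|Phi x| <= (Num.sqrt (2 * pi) / r) ^+ n.
Proof.
rewrite ger0_norm ?mulr_ge0 ?gaussn_ge0//.
by rewrite ler_piMr// gaussn_le1.
Qed.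

Let Phi_cintble (g : tupleR n -> R[i]) : cintble mu g ->
  cintble mu (fun t => g t * (Phi (rowv t))%:C).
Proof.
move=> gi; under eq_fun do rewrite mulrC.
apply: (@cintble_bounded _ _ _ _ _ _ ((Num.sqrt (2 * pi) / r) ^+ n)) => //.
- by move=> t; rewrite normc_real.
Qed.

(** Write [- |xi|^2 uh = uh - <xi>^2 uh] and use [uh2]. *)
Let duh2 : cintble mu (fun t => (- dot (rowv t) (rowv t))%:C * uh (rowv t)).
Proof.
have := cintbleB uhi uh2; congr (cintble mu _); apply/funext => t.
rewrite jbracket_sqr; apply: eq_complexP;
  rewrite ?(RecD, ImcD, RecN, ImcN, RecM, ImcM) /=; ring.
Qed.

(** Two pairings, each bringing one factor [A]: first [V] against [u phi], then, for each frequency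
    [s] of [V], [u] against [e^{i x.s} phi]. The phases add up to [Phi (z + s)], which is the
    convolution paired with [Phi]. *)
Let Vphi_pairing :
  A * (A * cint mu (fun t => V (rowv t) * (u (rowv t) * phi t))) =
  cint mu (fun t => convol v uh t * (Phi (rowv t))%:C).
Proof.
rewrite (cint_fourier_pairing Vb Vv); last exact: Cb_cintble.
rewrite (cint_convol vi uhi mPhi PhiM) -cintZ; last first.
  by apply: cintble_expi_pairing => //; exact: Cb_cintble.
apply: eq_cint => s; rewrite mulrCA; congr (_ * _).
transitivity (A * cint mu (fun t => u (rowv t) *
    (expi (dot (rowv t) (rowv s)) * phi t))).
  by congr (_ * _); apply: eq_cint => t; rewrite mulrCA.
rewrite (cint_fourier_pairing ub uuh); last exact: cintble_expi.
apply: eq_cint => z; congr (_ * _); rewrite -phiE; apply: eq_cint => t.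
by rewrite dotDr expiD mulrA.
Qed.

Lemma cint_equation_test :
  cint mu (fun t => ((jbracket (rowv t) ^+ 2)%:C * uh (rowv t) +
    ((2 * pi) ^- n)%:C * convol v uh t - fh (rowv t)) * (Phi (rowv t))%:C) = 0.
Proof.
have A0 : A != 0 :> R[i].
  by rewrite eq_complex /= eqxx andbT expf_neq0// gt_eqF// mulr_gt0// pi_gt0.
have kA : ((2 * pi) ^- n)%:C * A = 1 :> R[i].
  by rewrite -real_complexM mulVf// expf_neq0// gt_eqF// mulr_gt0// pi_gt0.
have E : (fun t : tupleR n => ((jbracket (rowv t) ^+ 2)%:C * uh (rowv t) +
    ((2 * pi) ^- n)%:C * convol v uh t - fh (rowv t)) * (Phi (rowv t))%:C) =
  fun t => ((uh (rowv t) * (Phi (rowv t))%:C -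
    ((- dot (rowv t) (rowv t))%:C * uh (rowv t)) * (Phi (rowv t))%:C) +
    ((2 * pi) ^- n)%:C * (convol v uh t * (Phi (rowv t))%:C)) -
    fh (rowv t) * (Phi (rowv t))%:C.
  apply/funext => t; rewrite jbracket_sqr.
  have -> : (1 + dot (rowv t) (rowv t))%:C = 1 - (- dot (rowv t) (rowv t))%:C :> R[i].
    by apply: eq_complexP; rewrite ?(RecD, ImcD, RecN, ImcN) /=; ring.
  ring.
have cvi := cintble_convol vi uhi.
have i1 := Phi_cintble uhi; have i2 := Phi_cintble duh2.
have i3 := Phi_cintble cvi; have i4 := Phi_cintble fhi.
rewrite E cintB//; last first.
  by apply: cintbleD; [exact: cintbleB|exact: cintbleZ].
rewrite cintD; [|exact: cintbleB|exact: cintbleZ].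
rewrite cintB// cintZ//.
have p1 : A * cint mu (fun t => u (rowv t) * phi t) =
    cint mu (fun t => uh (rowv t) * (Phi (rowv t))%:C).
  by rewrite (cint_fourier_pairing ub uuh phii); apply: eq_cint => t; rewrite phiE.
have p2 : A * cint mu (fun t => u (rowv t) * lphi t) =
    cint mu (fun t => (- dot (rowv t) (rowv t))%:C * uh (rowv t) * (Phi (rowv t))%:C).
  rewrite (cint_fourier_pairing ub uuh lphii); apply: eq_cint => t.
  by rewrite lphiE mulrA (mulrC (uh _)).
have p4 : A * cint mu (fun t => f (rowv t) * phi t) =
    cint mu (fun t => fh (rowv t) * (Phi (rowv t))%:C).
  by rewrite (cint_fourier_pairing fb ffh phii); apply: eq_cint => t; rewrite phiE.
(* The factor [(2 pi)^-n] cancels one of the two [A] of the convolution term, so [A] is common to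
   all terms; what remains is the equation tested on [mgauss r c]. *)
rewrite -p1 -p2 -p4 -Vphi_pairing !mulrA kA mul1r -mulrBr -mulrDr -mulrBr.
apply/eqP; rewrite mulf_eq0 (negbTE A0)/= subr_eq0; apply/eqP.
have := Vfu (schwartz_mgauss c r0).
rewrite -[X in _ -> _ = X]/(distribution_of f (mgauss r c)) => <-.
congr (_ + _); apply: eq_cint => t; exact: mulrA.
Qed.

End test_function.

Lemma fourier_side_equation :
  ae_eq mu setT (fun t => (jbracket (rowv t) ^+ 2)%:C * uh (rowv t))
    (fun t => fh (rowv t) - ((2 * pi) ^- n)%:C * convol v uh t).
Proof.
pose h t := (jbracket (rowv t) ^+ 2)%:C * uh (rowv t) +
    ((2 * pi) ^- n)%:C * convol v uh t - fh (rowv t) : R[i].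
have cvi := cintble_convol vi uhi.
have hi : cintble mu h.
  by apply: cintbleB => //; apply: cintbleD => //; exact: cintbleZ.
suff : ae_eq mu setT h (cst 0).
  apply: filterS => t /(_ I) /= ht _.
  by apply/eqP; rewrite -subr_eq0 opprB addrCA addrC -[X in _ == X]ht /h addrAC.
apply: cint_gaussn_eq0_ae => // r c r0.
have ri0 : 0 < r^-1 by rewrite invr_gt0.
have := cint_equation_test c ri0.
rewrite (_ : (fun t => _ * _) = fun t => ((Num.sqrt (2 * pi) / r^-1) ^+ n)%:C *
    (h t * (gaussn r (rowv t - c))%:C)); last first.
  by apply/funext => t; rewrite real_complexM !invrK /h; ring.
rewrite cintZ; last first.
  under eq_fun do rewrite mulrC; apply: (@cintble_bounded _ _ _ _ _ _ 1) => //.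
  - by apply: cmeasurable_real; exact: measurable_gaussn.
  - by move=> t; rewrite normc_real ger0_norm ?gaussn_ge0 ?gaussn_le1.
move/eqP; rewrite mulf_eq0 => /orP[|/eqP //].
rewrite eq_complex /= eqxx andbT expf_eq0 mulf_eq0 gt_eqF ?sqrt2pi_gt0//=.
by rewrite invrK gt_eqF// andbF.
Qed.

End fourier_side_equation.

(** * Weighted moments *)

(** When the right-hand side is infinite there is nothing to prove. Asking only for measurability
    lets [moment_convol] use the bound at every [t], whether or not the section of the kernel is
    integrable. *)
Lemma normc_cint_le d (T : measurableType d) (R : realType)
    (mu : {measure set T -> \bar R}) (f : T -> R[i]) : cmeasurable f ->
  ((normc (cint mu f))%:E <= \int[mu]_t (normc (f t))%:E)%E.
Proof.
move=> mf; have [->|foo] := eqVneq (\int[mu]_t (normc (f t))%:E)%E +oo%E.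
  exact: leey.
have fi : cintble mu f by apply/cintbleP; split => //; rewrite ltey.
have := normc_cint fi; rewrite -lee_fin /Rintegral fineK//.
apply: integrable_fin_num => //; exact: cintble_normc.
Qed.

Section moments.
Context {R : realType} {n : nat}.
Local Notation tupleR n := (n.-tuple (measurableTypeR R)).
Local Notation mu := (lebesgueRn R n).
Local Notation Rn := 'rV[R]_n.
Implicit Types (g f : Rn -> R[i]) (j : nat).

(** The [B^j] norm with an integer power, taken of a given representative. Extended real values
    allow bounds to be proved before finiteness is known. *)
Definition moment j g : \bar R :=
  (\int[mu]_t (jbracket (rowv t) ^+ j * normc (g (rowv t)))%:E)%E.

Lemma jbracketX_ge0 j (x : Rn) : 0 <= jbracket x ^+ j.
Proof. by rewrite exprn_ge0// ltW// jbracket_gt0. Qed.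

Lemma moment_ge0 j g : (0 <= moment j g)%E.
Proof.
by apply: integral_ge0 => t _; rewrite lee_fin mulr_ge0 ?normc_ge0 ?jbracketX_ge0.
Qed.

Lemma measurable_jbracketX j :
  measurable_fun setT (fun t : tupleR n => jbracket (rowv t) ^+ j).
Proof.
apply: measurable_funX; apply: measurable_continuous_rowv.
exact: continuous_jbracket.
Qed.

Lemma measurable_moment j g : cmeasurable (fun t : tupleR n => g (rowv t)) ->
  measurable_fun setT
    (fun t : tupleR n => (jbracket (rowv t) ^+ j * normc (g (rowv t)))%:E).
Proof.
move=> mg; apply/measurable_EFinP; apply: measurable_funM.
- exact: measurable_jbracketX.
- exact: measurable_normc.
Qed.

Lemma moment_le i j g : (i <= j)%N -> cmeasurable (fun t : tupleR n => g (rowv t)) ->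
  (moment i g <= moment j g)%E.
Proof.
move=> ij mg; apply: ge0_le_integral => //.
- by move=> t _; rewrite lee_fin mulr_ge0 ?normc_ge0 ?jbracketX_ge0.
- exact: measurable_moment.
- exact: measurable_moment.
- move=> t _; rewrite lee_fin ler_wpM2r ?normc_ge0//.
  by rewrite ler_weXn2l// jbracket_ge1.
Qed.

Lemma cintble_moment j g : cmeasurable (fun t : tupleR n => g (rowv t)) ->
  cintble mu (fun t => (jbracket (rowv t) ^+ j)%:C * g (rowv t)) <->
  (moment j g < +oo)%E.
Proof.
move=> mg; have E : (\int[mu]_t
    (normc ((jbracket (rowv t) ^+ j)%:C * g (rowv t)))%:E = moment j g)%E.
  apply: eq_integral => t _.
  by rewrite Normc.normcM normc_real ger0_norm ?jbracketX_ge0.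
have mw : cmeasurable (fun t : tupleR n => (jbracket (rowv t) ^+ j)%:C * g (rowv t)).
  by apply: cmeasurableM => //; apply: cmeasurable_real; exact: measurable_jbracketX.
by split=> [/cintbleP[_]|h]; [rewrite E|apply/cintbleP; rewrite E].
Qed.

Lemma ae_eq_moment j g1 g2 : cmeasurable (fun t : tupleR n => g1 (rowv t)) ->
  cmeasurable (fun t : tupleR n => g2 (rowv t)) ->
  ae_eq mu setT (fun t => g1 (rowv t)) (fun t => g2 (rowv t)) ->
  moment j g1 = moment j g2.
Proof.
move=> m1 m2 e; apply: ge0_ae_eq_integral => //.
- exact: measurable_moment.
- exact: measurable_moment.
- by move=> t _; rewrite lee_fin mulr_ge0 ?normc_ge0 ?jbracketX_ge0.
- by move=> t _; rewrite lee_fin mulr_ge0 ?normc_ge0 ?jbracketX_ge0.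
- by apply: filterS e => t /(_ I) -> _.
Qed.

(** Young's inequality in [L^1] with a weight: [<t>^j] is split over [s] and [t - s]. The constant
    [K] is 1 in [moment0_bound] and [2 ^+ j] in [moment_growth]. *)
Lemma moment_convol j K g h : 0 <= K ->
  (forall x y : Rn, jbracket (x + y) ^+ j <= K * (jbracket x ^+ j * jbracket y ^+ j)) ->
  cintble mu (fun t => g (rowv t)) -> cintble mu (fun t => h (rowv t)) ->
  (\int[mu]_t (jbracket (rowv t) ^+ j * normc (convol g h t))%:E <=
   K%:E * (moment j g * moment j h))%E.
Proof.
move=> K0 wK gi hi.
have mg := cintble_measurable gi; have mh := cintble_measurable hi.
pose a x := jbracket x ^+ j * normc (g x).
pose b x := jbracket x ^+ j * normc (h x).
have a0 x : 0 <= a x by rewrite mulr_ge0 ?normc_ge0 ?jbracketX_ge0.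
have b0 x : 0 <= b x by rewrite mulr_ge0 ?normc_ge0 ?jbracketX_ge0.
have ma : measurable_fun setT (fun t : tupleR n => a (rowv t)).
  by apply/measurable_EFinP; exact: measurable_moment.
have mb : measurable_fun setT (fun t : tupleR n => b (rowv t)).
  by apply/measurable_EFinP; exact: measurable_moment.
have mk : cmeasurable (@conv_kernel R n g h).
  exact: cintble_measurable (cintble_conv_kernel gi hi).
have mab : measurable_fun setT (fun p : tupleR n * tupleR n =>
    (a (rowv p.2) * b (rowv p.1 - rowv p.2))%:E).
  apply/measurable_EFinP; apply: measurable_funM; last exact: measurable_rowvB.
  exact: (measurableT_comp ma measurable_snd).
have mab_t t : measurable_fun setT (fun s : tupleR n =>
    (a (rowv s) * b (rowv t - rowv s))%:E).
  exact: (measurableT_comp mab (measurable_pair1 t)).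
have ab0 t s : (0 <= (a (rowv s) * b (rowv t - rowv s))%:E)%E.
  by rewrite lee_fin mulr_ge0.
apply: (@le_trans _ _ (\int[mu]_t (K%:E *
    \int[mu]_s (a (rowv s) * b (rowv t - rowv s))%:E))%E).
  apply: ge0_le_integral => //.
  - by move=> t _; rewrite lee_fin mulr_ge0 ?normc_ge0 ?jbracketX_ge0.
  - apply/measurable_EFinP; apply: measurable_funM.
      exact: measurable_jbracketX.
    exact: measurable_normc (cintble_measurable (cintble_convol gi hi)).
  - apply: emeasurable_funM => //.
    pose F (p : tupleR n * tupleR n) := (a (rowv p.2) * b (rowv p.1 - rowv p.2))%:E.
    apply: (@measurable_fun_fubini_tonelli_F _ _ _ _ R mu F) => // p.
    exact: ab0.
  - move=> t _; rewrite EFinM.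
    apply: (@le_trans _ _ ((jbracket (rowv t) ^+ j)%:E *
        \int[mu]_s (normc (conv_kernel g h (t, s)))%:E)%E).
      rewrite lee_wpmul2l ?lee_fin ?jbracketX_ge0//.
      apply: normc_cint_le; exact: (cmeasurable_comp mk (measurable_pair1 t)).
    rewrite -!ge0_integralZl ?lee_fin ?jbracketX_ge0//; last 2 first.
    - apply/measurable_EFinP; apply: measurable_normc.
      exact: (cmeasurable_comp mk (measurable_pair1 t)).
    - by move=> s _; rewrite lee_fin normc_ge0.
    apply: ge0_le_integral => //.
    + by move=> s _; rewrite lee_fin mulr_ge0 ?normc_ge0 ?jbracketX_ge0.
    + apply/measurable_EFinP/measurable_funM => //; apply: measurable_normc.
      exact: (cmeasurable_comp mk (measurable_pair1 t)).
    + exact: emeasurable_funM.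
    + move=> s _; rewrite -EFinM lee_fin /conv_kernel/= Normc.normcM /a /b.
      have := wK (rowv s) (rowv t - rowv s); rewrite addrC subrK.
      have := normc_ge0 (h (rowv t - rowv s)); have := normc_ge0 (g (rowv s)).
      move: (normc _) (normc _) => p q p0 q0 e.
      apply: (le_trans (ler_wpM2r (mulr_ge0 p0 q0) e)); rewrite le_eqVlt.
      by apply/orP; left; apply/eqP; ring.
rewrite (@integral_convolution R n (fun=> K) a b)//.
rewrite le_eqVlt; apply/orP; left; apply/eqP.
under eq_integral => s _.
  under eq_integral do rewrite mulrA EFinM.
  rewrite ge0_integralZl//; last 3 first.
  - exact/measurable_EFinP.
  - by move=> t _; rewrite lee_fin.
  - by rewrite lee_fin mulr_ge0.
  rewrite -/(moment j h) EFinM -muleA; over.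
have h0 := moment_ge0 j h.
rewrite ge0_integralZl ?lee_fin//; last 2 first.
- by apply: emeasurable_funM => //; exact/measurable_EFinP.
- by move=> s _; rewrite mule_ge0// lee_fin.
by rewrite ge0_integralZr//; [exact/measurable_EFinP|move=> s _; rewrite lee_fin].
Qed.

Section moment_bounds.
Variables v fh uh : Rn -> R[i].
Hypotheses (vi : cintble mu (fun t => v (rowv t)))
  (fhi : cintble mu (fun t => fh (rowv t))) (uhi : cintble mu (fun t => uh (rowv t))).
Let kappa : R := (2 * pi) ^- n.
Hypothesis eq_uh :
  ae_eq mu setT (fun t => (jbracket (rowv t) ^+ 2)%:C * uh (rowv t))
    (fun t => fh (rowv t) - kappa%:C * convol v uh t).

Let kappa_ge0 : 0 <= kappa.
Proof. by rewrite invr_ge0 exprn_ge0// mulr_ge0// pi_ge0. Qed.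

Lemma moment_step j K : 0 <= K ->
  (forall x y : Rn, jbracket (x + y) ^+ j <= K * (jbracket x ^+ j * jbracket y ^+ j)) ->
  (moment j.+2 uh <= moment j fh + (kappa * K)%:E * (moment j v * moment j uh))%E.
Proof.
move=> K0 wK.
have mu_ := cintble_measurable uhi; have mf := cintble_measurable fhi.
have mc := cintble_measurable (cintble_convol vi uhi).
have mwc : measurable_fun setT (fun t =>
    (jbracket (rowv t) ^+ j * normc (convol v uh t))%:E).
  apply/measurable_EFinP/measurable_funM; first exact: measurable_jbracketX.
  exact: measurable_normc.
have wc0 t : (0 <= (jbracket (rowv t) ^+ j * normc (convol v uh t))%:E)%E.
  by rewrite lee_fin mulr_ge0 ?normc_ge0 ?jbracketX_ge0.
apply: (@le_trans _ _ (\int[mu]_t ((jbracket (rowv t) ^+ j * normc (fh (rowv t)))%:E +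
    kappa%:E * (jbracket (rowv t) ^+ j * normc (convol v uh t))%:E))%E).
  apply: ae_ge0_le_integral => //.
  - by move=> t _; rewrite lee_fin mulr_ge0 ?normc_ge0 ?jbracketX_ge0.
  - exact: measurable_moment.
  - move=> t _; rewrite adde_ge0//; last by rewrite mule_ge0.
    by rewrite lee_fin mulr_ge0 ?normc_ge0 ?jbracketX_ge0.
  - apply: emeasurable_funD; first exact: measurable_moment.
    exact: emeasurable_funM.
  - apply: filterS eq_uh => t /(_ I) /(congr1 (@normc R)) e _.
    rewrite -EFinM -EFinD lee_fin -addn2 exprD -mulrA.
    move: e; rewrite Normc.normcM normc_real ger0_norm ?jbracketX_ge0// => ->.
    rewrite [leRHS](_ : _ = jbracket (rowv t) ^+ j * (normc (fh (rowv t)) +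
      kappa * normc (convol v uh t))); last by ring.
    rewrite ler_wpM2l ?jbracketX_ge0//.
    apply: (le_trans (le_normcD _ _)).
    rewrite [X in _ + X](normcN _).
    by rewrite Normc.normcM normc_real ger0_norm.
rewrite ge0_integralD//; last 4 first.
- by move=> t _; rewrite lee_fin mulr_ge0 ?normc_ge0 ?jbracketX_ge0.
- exact: measurable_moment.
- by move=> t _; rewrite mule_ge0.
- exact: emeasurable_funM.
rewrite leeD2l// ge0_integralZl// EFinM -muleA lee_wpmul2l ?lee_fin//.
exact: moment_convol.
Qed.

Variables (k : nat) (W F : R).
Hypotheses (vk : (moment k v <= W%:E)%E) (fk : (moment k fh <= F%:E)%E).

(** For [j <= k] the moments of [v] and [fh] are bounded by those of order [k], so that one pair
    [W], [F] serves the whole climb. *)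
Lemma moment_growth j c : (j <= k)%N -> 0 <= c ->
  (moment j uh <= (c * F)%:E)%E ->
  (moment j.+2 uh <= ((1 + kappa * 2 ^+ j * (W * c)) * F)%:E)%E.
Proof.
move=> jk c0 uj; apply: (le_trans (@moment_step j (2 ^+ j) _ _)) => //.
  move=> x y; rewrite -!exprMn lerXn2r ?nnegrE ?jbracketD_le//.
  - exact/ltW/jbracket_gt0.
  - by rewrite !mulr_ge0// ltW// jbracket_gt0.
have k2 : 0 <= kappa * 2 ^+ j by rewrite mulr_ge0// exprn_ge0.
rewrite mulrDl mul1r EFinD leeD//.
  exact: le_trans (moment_le jk (cintble_measurable fhi)) fk.
rewrite -!mulrA EFinM mulrA (EFinM _ (W * _)) lee_wpmul2l ?lee_fin//.
rewrite EFinM lee_pmul ?moment_ge0//.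
exact: le_trans (moment_le jk (cintble_measurable vi)) vk.
Qed.

Lemma moment0_bound (theta : R) : (kappa%:E * moment 0 v <= theta%:E)%E -> theta < 1 ->
  (moment 0 uh <= ((1 - theta)^-1 * F)%:E)%E.
Proof.
move=> vtheta theta1.
(* Finiteness is what permits absorption: for an infinite moment the inequality [h] would carry no
   information. *)
have [U UE] : exists U, moment 0 uh = U%:E.
  have /cintbleP[_] := uhi; rewrite (_ : integral _ _ _ = moment 0 uh) => [uoo|].
    by exists (fine (moment 0 uh)); rewrite fineK// ge0_fin_numE ?moment_ge0.
  by apply: eq_integral => t _; rewrite expr0 mul1r.
have U0 : 0 <= U by rewrite -lee_fin -UE moment_ge0.
have h : (moment 0 uh <= F%:E + theta%:E * moment 0 uh)%E.
  apply: (le_trans (moment_le (leq0n 2) (cintble_measurable uhi))).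
  apply: (le_trans (@moment_step 0 1 _ _)) => //.
    by move=> x y; rewrite !expr0 !mulr1.
  rewrite leeD//.
    exact: le_trans (moment_le (leq0n k) (cintble_measurable fhi)) fk.
  by rewrite mulr1 muleA lee_wpmul2r// moment_ge0.
move: h; rewrite UE -EFinM -EFinD !lee_fin => h.
by rewrite mulrC ler_pdivlMr ?subr_gt0//; lra.
Qed.

End moment_bounds.

(** * The spaces B^k in terms of moments *)

Lemma is_fourier_hat f g : is_fourier f g -> is_fourier f (hat f).
Proof. by move=> fg; exact: (xgetPex _ (ex_intro _ g fg)). Qed.

Lemma normB_moment j f : normB j%:R f = moment j (hat f).
Proof.
by apply: eq_integral => t _; rewrite powR_mulrn// ltW// jbracket_gt0.
Qed.

(** Membership speaks of some representative, the norm of the chosen one [hat f]; uniqueness almost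
    everywhere gives them the same moments. *)
Lemma B_natP j f : B j%:R f <->
  [/\ Cb f, is_fourier f (hat f) & (moment j (hat f) < +oo)%E].
Proof.
have E g : (fun t : tupleR n => (jbracket (rowv t) ^+ j)%:C * g (rowv t)) =
    (fun t => (jbracket (rowv t) `^ j%:R)%:C * g (rowv t)).
  by apply/funext => t; rewrite powR_mulrn// ltW// jbracket_gt0.
have mF g : is_fourier f g -> cmeasurable (fun t : tupleR n => g (rowv t)).
  by move=> [/cintble_measurable].
split=> [[fb [g fg gj]]|[fb fh fj]].
  have fh := is_fourier_hat fg; split => //.
  rewrite (ae_eq_moment j (mF _ fh) (mF _ fg) (is_fourier_unique fb fh fg)).
  by apply/cintble_moment; [exact: mF|rewrite E].
split=> //; exists (hat f) => //.
have /(cintble_moment j) [_ /(_ fj)] := mF _ fh.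
by rewrite E.
Qed.

End moments.

Theorem theorem3p2 (R : realType) (n k : nat) (n_gt0 : (0 < n)%N)
    (V : 'rV[R]_n -> R[i]) (VB : B k%:R V)
    (V_small : (((2 * pi) ^- n)%:E * normB 0 V < 1)%E) :
  exists c : R, 0 < c /\
    forall f : 'rV[R]_n -> R[i], B k%:R f ->
    forall u : 'rV[R]_n -> R[i], B 2 u -> solves V f u ->
      B (k + 2)%:R u /\ (normB (k + 2)%:R u <= c%:E * normB k%:R f)%E.
Proof.
have /B_natP[Vb Vh Vk] := VB.
have vi : cintble (lebesgueRn R n) (fun t => hat V (rowv t)) by case: Vh.
have Wfin : moment k (hat V) \is a fin_num by rewrite ge0_fin_numE ?moment_ge0.
pose W := fine (moment k (hat V)).
have W0 : 0 <= W by rewrite fine_ge0// moment_ge0.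
have vW : (moment k (hat V) <= W%:E)%E by rewrite fineK.
pose kappa : R := (2 * pi) ^- n.
have kappa0 : 0 <= kappa by rewrite invr_ge0 exprn_ge0// mulr_ge0// pi_ge0.
have V0fin : moment 0 (hat V) \is a fin_num.
  rewrite ge0_fin_numE ?moment_ge0// (le_lt_trans _ Vk)// moment_le//.
  exact: cintble_measurable vi.
pose theta := kappa * fine (moment 0 (hat V)).
have vtheta : (kappa%:E * moment 0 (hat V) <= theta%:E)%E by rewrite EFinM fineK.
have theta1 : theta < 1.
  by move: V_small; rewrite (normB_moment 0 V) -lte_fin EFinM fineK.
(* [c] starts with the absorption constant of [moment0_bound] and follows [moment_growth]; it
   depends on [n], [k] and [V] only. Since [c j.+1] bounds order [j + 2], the constant for order
   [k + 2] is [c k.+1]. *)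
pose fix c j : R :=
  if j is i.+1 then 1 + kappa * 2 ^+ i * (W * c i) else (1 - theta)^-1.
have c0 j : 0 < c j.
  case: j => [|j]; first by rewrite /= invr_gt0 subr_gt0.
  elim: j => [|j ih] /=; rewrite ltr_wpDr ?mulr_ge0 ?exprn_ge0//.
  - by rewrite invr_ge0 subr_ge0 ltW.
  - exact: ltW.
exists (c k.+1); split => // f /B_natP[fb fh fk].
have fhi : cintble (lebesgueRn R n) (fun t => hat f (rowv t)) by case: fh.
have Ffin : moment k (hat f) \is a fin_num by rewrite ge0_fin_numE ?moment_ge0.
pose F := fine (moment k (hat f)).
have fF : (moment k (hat f) <= F%:E)%E by rewrite fineK.
move=> u /(B_natP 2) [ub uh u2].
have uhi : cintble (lebesgueRn R n) (fun t => hat u (rowv t)) by case: uh.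
have uh2 : cintble (lebesgueRn R n)
    (fun t => (jbracket (rowv t) ^+ 2)%:C * hat u (rowv t)).
  by apply/cintble_moment => //; exact: cintble_measurable uhi.
move=> /(fourier_side_equation Vb fb ub Vh fh uh uh2) equ.
have growth j : (j <= k)%N -> (moment j (hat u) <= (c j * F)%:E)%E ->
    (moment j.+2 (hat u) <= (c j.+1 * F)%:E)%E.
  move=> jk; exact: (moment_growth vi fhi uhi equ vW fF jk (ltW (c0 j))).
(* Of the two orders gained at each step only one is kept, so that every order up to [k] is reached;
   the full gain is used once, in [main]. *)
have bound j : (j <= k)%N -> (moment j (hat u) <= (c j * F)%:E)%E.
  elim: j => [_|j ih jk]; first exact: (moment0_bound vi fhi uhi equ fF vtheta).
  apply: le_trans (growth j (ltnW jk) (ih (ltnW jk))).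
  exact: moment_le (cintble_measurable uhi).
have main := growth k (leqnn k) (bound k (leqnn k)).
rewrite addn2 !normB_moment -[moment k _]fineK// -EFinM; split => //.
by apply/B_natP; split; [exact: ub|exact: uh|exact: le_lt_trans main (ltry _)].
Qed.
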